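(* Let $A$ be a right angled Artin group whose Artin presentation graph is a tree of diameter at least $3$. Then every asymptotic cone of $A$ has cut-points, and $A$ is algebraically thick of order $1$.
   Context: A right angled Artin group with presentation graph a finite simplicial graph $\mathcal G_A$ is the group with one generator for each vertex of $\mathcal G_A$ and with defining relations that two generators commute whenever the corresponding vertices are joined by an edge. Unconstricted groups. For a finitely generated group with a word metric, an asymptotic cone is an $\omega$-ultralimit of $(G,1,\frac1{d_n}\mathrm{dist})$ for a non-principal ultrafilter $\omega$ on $\mathbb N$ and positive $d_n$ with $\lim_\omega d_n=\infty$. Cut-points are global cut-points, and a singleton is considered to have a cut-point. An infinite finitely generated group is unconstricted if at least one of its asymptotic cones has no cut-points. Undistorted subgroup: a finitely generated subgroup $H$ of $G$ such that any word metric on $H$ is bi-Lipschitz equivalent to the restriction to $H$ of a word metric of $G$. Algebraic network. Let $G$ be a finitely generated group, $\mathcal H$ a finite non-empty collection of subgroups and $M>0$. $G$ is an $M$-algebraic network with respect to $\mathcal H$ if: (AN$_0$) all subgroups in $\mathcal H$ are finitely generated and undistorted in $G$; (AN$_1$) there is a finite index subgroup $G_1$ of $G$ such that $G$ is contained in the $M$-neighborhood of $G_1$ and a finite generating set of $G_1$ is contained in $\bigcup_{H\in\mathcal H}H$; (AN$_2$) any $H,H'\in\mathcal H$ are joined by a finite sequence $H=H_1,\dots,H_n=H'$ in $\mathcal H$ with $H_i\cap H_{i+1}$ infinite for all $1\le i<n$. Algebraic thickness. $G$ is algebraically thick of order zero if it is unconstricted; it is algebraically thick of order at most one if it is unconstricted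 or if, for some $M>0$ and some finite collection $\mathcal H$ of unconstricted subgroups, it is an $M$-algebraic network with respect to $\mathcal H$. It is algebraically thick of order $1$ if it is algebraically thick of order at most one but not of order zero. *)

(* Defs.v *)
From HB Require Import structures.
From mathcomp Require Import all_boot all_order all_algebra.
From mathcomp Require Import generic_quotient.
From mathcomp Require Import all_classical reals ereal topology normedtype.

Set Implicit Arguments.
Unset Strict Implicit.
Unset Printing Implicit Defensive.

Import Order.TTheory GRing.Theory Num.Theory.
Import numFieldNormedType.Exports.

Local Open Scope classical_set_scope.
Local Open Scope ring_scope.

Section Graphs.
Context (T : finType) (e : rel T).

Definition simplicial_graph := symmetric e /\ irreflexive e.

(* The bound 2 is there because a single edge {x, y} gives the closed path
   [:: x; y]. *)
Definition is_tree :=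
  [/\ (0 < #|T|)%N, forall x y, connect e x y
    & forall c : seq T, ucycle e c -> (size c <= 2)%N].

(* Length of a shortest path; it is #|T| when y is not reachable from x
   (a shortest path has fewer than #|T| edges). *)
Definition graph_dist (x y : T) : nat :=
  \big[minn/#|T|]_(n < #|T| |
    [exists p : n.-tuple T, path e x p && (last x p == y)]) n.

Definition diameter : nat := \max_(x : T) \max_(y : T) graph_dist x y.

End Graphs.

Section Presentation.
Local Open Scope quotient_scope.
Context (T : choiceType).

(* The letter (x, false) is the generator x, (x, true) is its formal inverse. *)
Definition gword := seq (T * bool).

Definition gword_inv (w : gword) : gword :=
  rev [seq (l.1, ~~ l.2) | l <- w].

Context (rels : gword -> gword -> Prop).

Inductive pres_eq : gword -> gword -> Prop :=
| pres_refl u : pres_eq u u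
| pres_sym u v : pres_eq u v -> pres_eq v u
| pres_trans v u w : pres_eq u v -> pres_eq v w -> pres_eq u w
| pres_cancel u v x b : pres_eq (u ++ [:: (x, b), (x, ~~ b) & v]) (u ++ v)
| pres_relation u v r s : rels r s -> pres_eq (u ++ r ++ v) (u ++ s ++ v).

Lemma pres_eq_cat u u' v v' :
  pres_eq u u' -> pres_eq v v' -> pres_eq (u ++ v) (u' ++ v').
Proof.
move=> uu' vv'; apply: (@pres_trans (u' ++ v)).
  elim: uu' => {u u'} [u|u u' _|u' u u'' _ + _|u u' x b|u u' r s rs].
  - exact: pres_refl.
  - exact: pres_sym.
  - exact: pres_trans.
  - by rewrite -!catA /=; exact: pres_cancel.
  - by rewrite -!catA; exact: pres_relation.
elim: vv' => {v v'} [v|v v' _|v' v v'' _ + _|v v' x b|v v' r s rs].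
- exact: pres_refl.
- exact: pres_sym.
- exact: pres_trans.
- by rewrite !catA; exact: pres_cancel.
- by rewrite !(catA u'); exact: pres_relation.
Qed.

Lemma gword_invK : involutive gword_inv.
Proof.
move=> w; rewrite /gword_inv map_rev revK -map_comp -[RHS]map_id.
by apply: eq_map => -[x b] /=; rewrite negbK.
Qed.

Lemma pres_eq_divr w : pres_eq (w ++ gword_inv w) [::].
Proof.
elim: w => [|[x b] w IH] /=; first exact: pres_refl.
rewrite /gword_inv /= rev_cons -cats1 catA -/(gword_inv w).
apply: (@pres_trans ([:: (x, b)] ++ [::] ++ [:: (x, ~~ b)])).
  rewrite -cat_cons -cat1s -!catA; apply: pres_eq_cat; first exact: pres_refl.
  by rewrite catA; apply: pres_eq_cat => //; exact: pres_refl.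
exact: (pres_cancel [::] [::]).
Qed.

Lemma pres_eq_divl w : pres_eq (gword_inv w ++ w) [::].
Proof. by rewrite -{2}(gword_invK w); exact: pres_eq_divr. Qed.

Lemma pres_eq_inv u v : pres_eq u v -> pres_eq (gword_inv u) (gword_inv v).
Proof.
move=> uv; apply: (@pres_trans (gword_inv u ++ (v ++ gword_inv v))).
  rewrite -{1}[gword_inv u]cats0; apply: pres_eq_cat; first exact: pres_refl.
  exact/pres_sym/pres_eq_divr.
rewrite catA -{2}[gword_inv v]cat0s.
apply: pres_eq_cat; last exact: pres_refl.
apply: (pres_trans _ (pres_eq_divl u)).
by apply: pres_eq_cat; [exact: pres_refl|exact: pres_sym].
Qed.

Definition pres_eqb : rel gword := fun u v => `[< pres_eq u v >].

Lemma pres_eqb_refl : reflexive pres_eqb.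
Proof. by move=> u; apply/asboolP/pres_refl. Qed.

Lemma pres_eqb_sym : symmetric pres_eqb.
Proof. by move=> u v; apply/asboolP/asboolP; exact: pres_sym. Qed.

Lemma pres_eqb_trans : transitive pres_eqb.
Proof.
by move=> v u w /asboolP uv /asboolP vw; apply/asboolP; exact: pres_trans vw.
Qed.

Canonical pres_equiv :=
  EquivRel pres_eqb pres_eqb_refl pres_eqb_sym pres_eqb_trans.

Definition presented_group : Type := {eq_quot pres_equiv}.

HB.instance Definition _ := Choice.on presented_group.
HB.instance Definition _ :=
  EqQuotient.copy presented_group {eq_quot pres_equiv}.

Definition word_class (w : gword) : presented_group := \pi_presented_group w.

Let pg_one : presented_group := word_class [::].
Let pg_mul (a b : presented_group) := word_class (repr a ++ repr b).
Let pg_inv (a : presented_group) := word_class (gword_inv (repr a)).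

Lemma word_classP u v : word_class u = word_class v <-> pres_eq u v.
Proof. by split => [/eqquotP/asboolP|uv]//; apply/eqquotP/asboolP. Qed.

Lemma word_classK a : word_class (repr a) = a.
Proof. exact: reprK. Qed.

Lemma repr_word_class w : pres_eq (repr (word_class w)) w.
Proof. by apply/word_classP; rewrite word_classK. Qed.

Let pg_mulE u v : pg_mul (word_class u) (word_class v) = word_class (u ++ v).
Proof.
by apply/word_classP; apply: pres_eq_cat; exact: repr_word_class.
Qed.

Let pg_invE u : pg_inv (word_class u) = word_class (gword_inv u).
Proof. by apply/word_classP/pres_eq_inv/repr_word_class. Qed.

Let pg_mulA : associative pg_mul.
Proof.
move=> a b c; rewrite -[a]word_classK -[b]word_classK -[c]word_classK.
by rewrite !pg_mulE catA.
Qed.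

Let pg_mul1 : left_id pg_one pg_mul.
Proof. by move=> a; rewrite -[a]word_classK pg_mulE. Qed.

Let pg_mulr1 : right_id pg_one pg_mul.
Proof. by move=> a; rewrite -[a]word_classK pg_mulE cats0. Qed.

Let pg_mulV : left_inverse pg_one pg_inv pg_mul.
Proof.
move=> a; rewrite -[a]word_classK pg_invE pg_mulE.
by apply/word_classP; exact: pres_eq_divl.
Qed.

Let pg_mulrV : right_inverse pg_one pg_inv pg_mul.
Proof.
move=> a; rewrite -[a]word_classK pg_invE pg_mulE.
by apply/word_classP; exact: pres_eq_divr.
Qed.

HB.instance Definition _ := isGroup.Build presented_group
  pg_mulA pg_mul1 pg_mulr1 pg_mulV pg_mulrV.

Lemma word_class_cat u v :
  word_class (u ++ v) = (word_class u * word_class v)%g.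
Proof. by rewrite -pg_mulE. Qed.

Lemma word_class_inv u : word_class (gword_inv u) = ((word_class u)^-1)%g.
Proof. by rewrite -pg_invE. Qed.

End Presentation.

Section RAAG.
Context (T : finType) (e : rel T).

Definition artin_relation (r s : gword T) : Prop :=
  exists x y, [/\ e x y, r = [:: (x, false); (y, false)]
                       & s = [:: (y, false); (x, false)]].

Definition raag : groupType := presented_group artin_relation.

End RAAG.

Section WordLength.
Local Open Scope group_scope.
Context (G : groupType).

Definition products (S : set G) (n : nat) : set G :=
  [set g | exists s : seq G, [/\ size s = n,
     (forall x, x \in s -> S x \/ S x^-1) & g = \prod_(x <- s) x]].

Definition generates (S : set G) := forall g, exists n, products S n g.

Record generating_set := GeneratingSet {
  gens :> set G;
  gens_finite : finite_set gens;
  gens_generate : generates gens }.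

Definition finitely_generated := exists S : set G, finite_set S /\ generates S.

Definition is_word_length (S : set G) (g : G) (n : nat) : Prop :=
  products S n g /\ forall m, products S m g -> (n <= m)%N.

Definition word_length (S : set G) (g : G) : nat := xget 0%N (is_word_length S g).

Definition word_dist (S : set G) (x y : G) : nat := word_length S (x^-1 * y).

Lemma products1 (S : set G) : products S 0 1.
Proof. by exists [::]; rewrite big_nil. Qed.

Lemma productsM (S : set G) m n x y :
  products S m x -> products S n y -> products S (m + n) (x * y).
Proof.
move=> [s [<- Ss ->]] [t [<- St ->]]; exists (s ++ t).
split; [exact: size_cat| |by rewrite big_cat].
by move=> z; rewrite mem_cat => /orP[/Ss|/St].
Qed.

Lemma productsV (S : set G) n x : products S n x -> products S n x^-1.
Proof.
move=> [s [<- + ->]]; elim: s => [|a s IH] Ss.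
  by rewrite big_nil invg1; exact: products1.
rewrite big_cons invgM /= -addn1; apply: productsM.
  by apply: IH => z zs; apply: Ss; rewrite inE zs orbT.
exists [:: a^-1]; split => //; last by rewrite big_seq1.
move=> z; rewrite inE => /eqP ->; rewrite invgK.
by case: (Ss a); rewrite ?inE ?eqxx //; [right|left].
Qed.

Lemma word_lengthP (S : generating_set) g :
  is_word_length S g (word_length S g).
Proof.
apply: (xgetPex 0%N).
have exP : exists n, `[< products S n g >].
  by have [n Sn] := gens_generate S g; exists n; apply/asboolP.
by case: (ex_minnP exP) => n /asboolP ? min_n; exists n; split => // m ?;
  apply: min_n; apply/asboolP.
Qed.

End WordLength.

(* Synonym of G; R and S are phantom arguments selecting the metric instance
   below. *)
Definition word_space (R : realType) (G : groupType) (S : generating_set G) : Type :=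
  G.

Section WordSpace.
Local Open Scope group_scope.
Context (R : realType) (G : groupType) (S : generating_set G).

Local Notation word_space := (word_space R S).

HB.instance Definition _ := Choice.copy word_space G.

Let wdist (x y : word_space) : R := (word_dist S x y)%:R.

Let wdistxx x : wdist x x = 0%R.
Proof.
rewrite /wdist /word_dist mulVg; have [_ /(_ _ (products1 S))] := word_lengthP S 1.
by rewrite leqn0 => /eqP ->.
Qed.

Let wdist_positivity x y : wdist x y = 0%R -> x = y.
Proof.
move=> /eqP; rewrite pnatr_eq0 => /eqP xy0.
have [+ _] := word_lengthP S (x^-1 * y).
rewrite -/(word_dist S x y) xy0 => -[s [/size0nil -> _]].
by rewrite big_nil => /(congr1 (fun z => x * z)); rewrite mulVKg mulg1.
Qed.

Let wdist_sym x y : wdist x y = wdist y x.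
Proof.
suff H a b : (word_dist S a b <= word_dist S b a)%N.
  by congr _%:R; apply/eqP; rewrite eqn_leq !H.
have [_] := word_lengthP S (a^-1 * b); apply.
rewrite -[a^-1 * b]invgK; apply: productsV; rewrite invgM invgK.
by have [] := word_lengthP S (b^-1 * a).
Qed.

Let wdist_triangle y x z : (wdist x z <= wdist x y + wdist y z)%R.
Proof.
rewrite -natrD ler_nat; have [_] := word_lengthP S (x^-1 * z); apply.
rewrite (_ : x^-1 * z = (x^-1 * y) * (y^-1 * z)); last first.
  by rewrite mulgA mulgK.
by apply: productsM; [have [] := word_lengthP S (x^-1 * y)|
                      have [] := word_lengthP S (y^-1 * z)].
Qed.

HB.instance Definition _ := @isMetric.Build R word_space
  wdist wdistxx wdist_positivity wdist_sym wdist_triangle.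

Lemma word_space_mdistE (x y : word_space) : mdist x y = (word_dist S x y)%:R.
Proof. by []. Qed.

End WordSpace.

(* Synonym of X; c is a phantom argument selecting the metric instance below. *)
Definition rescale_space (R : realType) (c : {posnum R}) (X : metricType R) : Type :=
  X.

Section Rescale.
Context (R : realType) (c : {posnum R}) (X : metricType R).

Local Notation rescale := (rescale_space c X).

HB.instance Definition _ := Choice.copy rescale X.

Let rdist (x y : rescale) : R := c%:num * mdist (x : X) (y : X).

Let rdistxx x : rdist x x = 0.
Proof. by rewrite /rdist mdistxx mulr0. Qed.

Let rdist_positivity x y : rdist x y = 0 -> x = y.
Proof.
by move/eqP; rewrite mulf_eq0 gt_eqF //= => /eqP/mdist_positivity.
Qed.

Let rdist_sym x y : rdist x y = rdist y x.
Proof. by rewrite /rdist metric_sym. Qed.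

Let rdist_triangle y x z : rdist x z <= rdist x y + rdist y z.
Proof. by rewrite -mulrDr ler_pM2l // metric_triangle. Qed.

HB.instance Definition _ := @isMetric.Build R rescale
  rdist rdistxx rdist_positivity rdist_sym rdist_triangle.

Lemma rescale_mdistE (x y : rescale) :
  mdist x y = c%:num * mdist (x : X) (y : X).
Proof. by []. Qed.

End Rescale.

Definition nonprincipal (w : set_system nat) : Prop :=
  forall n, w <> principal_filter n.

Lemma ultra_cvg_bounded (R : realType) (w : set_system nat) (f : nat -> R)
    (C : R) : UltraFilter w ->
  (\forall n \near w, `|f n| <= C) -> cvg (f n @[n --> w]).
Proof.
move=> Uw fC; have Ufw : UltraFilter (f @ w).
  split=> [|H PH fwH]; first exact: fmap_proper_filter.
  apply/seteqP; split => // B HB.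
  have [//|wB] := in_ultra_setVsetC (f @^-1` B) Uw.
  have /fwH HnB : (f @ w) (~` B) by [].
  have : H (B `&` ~` B) by exact: filterI.
  by rewrite setICr => /filter_not_empty.
have := @segment_compact R (- C) C; rewrite compact_ultra => /(_ _ Ufw)[].
  apply: filterS fC => n /=; rewrite ler_norml in_itv /=.
  by [].
by move=> l [_ fl]; apply/cvg_ex; exists l.
Qed.

Section Ultralimit.
Local Open Scope quotient_scope.
Context (R : realType) (w : set_system nat) (Uw : UltraFilter w)
  (X : nat -> metricType R) (o : forall n, X n).

(* For an ultrafilter w the limit of dist (x n, o n) along w always exists in
   [0, +oo], so convergence in R says that this limit is finite. *)
Definition admissible (x : forall n, X n) : bool :=
  `[< cvg (mdist (x n) (o n) @[n --> w]) >].

Definition ulim_seq : Type := {x : forall n, X n | admissible x}.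

HB.instance Definition _ := Choice.on ulim_seq.

Definition ulim_dist (x y : ulim_seq) : R :=
  lim (mdist (val x n) (val y n) @[n --> w]).

Lemma ulim_dist_cvg (x y : ulim_seq) :
  mdist (val x n) (val y n) @[n --> w] --> ulim_dist x y.
Proof.
have /asboolP/cvg_ex[a xa] := valP x.
have /asboolP/cvg_ex[b yb] := valP y.
apply: (@ultra_cvg_bounded R w _ ((a + 1) + (b + 1))).
have xa1 : \forall n \near w, mdist (val x n) (o n) < a + 1.
  by apply: (cvgr_lt _ xa); rewrite ltrDl.
have yb1 : \forall n \near w, mdist (val y n) (o n) < b + 1.
  by apply: (cvgr_lt _ yb); rewrite ltrDl.
apply: filterS2 xa1 yb1 => n xn yn; rewrite ger0_norm ?mdist_ge0 //.
apply: (le_trans (metric_triangle _ (o n) _)).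
by rewrite (metric_sym (o n)) lerD // ltW.
Qed.

Lemma ulim_distxx x : ulim_dist x x = 0.
Proof.
rewrite /ulim_dist.
under eq_fun do rewrite mdistxx.
exact: lim_cst.
Qed.

Lemma ulim_dist_sym x y : ulim_dist x y = ulim_dist y x.
Proof. by rewrite /ulim_dist; under eq_fun do rewrite metric_sym. Qed.

Lemma ulim_dist_ge0 x y : 0 <= ulim_dist x y.
Proof.
apply: limr_ge; first exact: ulim_dist_cvg.
by apply: nearW => n; exact: mdist_ge0.
Qed.

Lemma ulim_dist_triangle y x z :
  ulim_dist x z <= ulim_dist x y + ulim_dist y z.
Proof.
have xyz := @cvgD _ _ _ w _ _ _ _ _ (@ulim_dist_cvg x y) (@ulim_dist_cvg y z).
apply: (ler_cvg_to (@ulim_dist_cvg x z) (xyz _)).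
by apply: nearW => n; exact: metric_triangle.
Qed.

Definition ulim_eqb : rel ulim_seq := fun x y => ulim_dist x y == 0.

Lemma ulim_eqb_refl : reflexive ulim_eqb.
Proof. by move=> x; apply/eqP/ulim_distxx. Qed.

Lemma ulim_eqb_sym : symmetric ulim_eqb.
Proof. by move=> x y; rewrite /ulim_eqb ulim_dist_sym. Qed.

Lemma ulim_eqb_trans : transitive ulim_eqb.
Proof.
move=> y x z /eqP xy /eqP yz; rewrite /ulim_eqb eq_le ulim_dist_ge0 andbT.
by rewrite (le_trans (ulim_dist_triangle y x z)) // xy yz addr0.
Qed.

Canonical ulim_equiv :=
  EquivRel ulim_eqb ulim_eqb_refl ulim_eqb_sym ulim_eqb_trans.

Definition ultralimit : Type := {eq_quot ulim_equiv}.

HB.instance Definition _ := Choice.on ultralimit.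
HB.instance Definition _ := EqQuotient.copy ultralimit {eq_quot ulim_equiv}.

Let qdist (a b : ultralimit) : R := ulim_dist (repr a) (repr b).

Let qdistxx a : qdist a a = 0.
Proof. exact: ulim_distxx. Qed.

Let qdist_positivity a b : qdist a b = 0 -> a = b.
Proof.
by move=> ab; rewrite -[a]reprK -[b]reprK; apply/eqquotP/eqP.
Qed.

Let qdist_sym a b : qdist a b = qdist b a.
Proof. exact: ulim_dist_sym. Qed.

Let qdist_triangle b a c : qdist a c <= qdist a b + qdist b c.
Proof. exact: ulim_dist_triangle. Qed.

HB.instance Definition _ := @isMetric.Build R ultralimit
  qdist qdistxx qdist_positivity qdist_sym qdist_triangle.

Definition ulim_class (x : ulim_seq) : ultralimit := \pi_ultralimit x.

Lemma ultralimit_mdistE (x y : ulim_seq) :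
  mdist (ulim_class x) (ulim_class y) = ulim_dist x y.
Proof.
have H z : ulim_dist (repr (ulim_class z)) z = 0.
  by apply/eqP; apply/(@eqquotP _ _ ultralimit); rewrite reprK.
apply/eqP; rewrite eq_le; apply/andP; split.
  apply: (le_trans (ulim_dist_triangle x _ _)); rewrite H add0r.
  apply: (le_trans (ulim_dist_triangle y _ _)).
  by rewrite (ulim_dist_sym y) H addr0.
apply: (le_trans (ulim_dist_triangle (repr (ulim_class x)) _ _)).
rewrite ulim_dist_sym H add0r.
by apply: (le_trans (ulim_dist_triangle (repr (ulim_class y)) _ _)); rewrite H addr0.
Qed.

End Ultralimit.

Definition asymptotic_cone (R : realType) (G : groupType)
    (S : generating_set G) (w : set_system nat) (Uw : UltraFilter w)
    (d : nat -> {posnum R}) : metricType R :=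
  ultralimit Uw
    (X := fun n => rescale_space ((d n)%:num^-1)%:pos (word_space R S))
    (fun=> 1%g).

(* The second disjunct is the convention that a singleton has a cut-point. *)
Definition cut_point (X : topologicalType) (p : X) : Prop :=
  ~ connected (~` [set p]) \/ [set: X] = [set p].

Definition has_cut_point (X : topologicalType) : Prop :=
  exists p : X, cut_point p.

Definition unconstricted (R : realType) (G : groupType) : Prop :=
  [/\ infinite_set [set: G], finitely_generated G
    & exists (S : generating_set G) (w : set_system nat) (Uw : UltraFilter w)
        (d : nat -> {posnum R}),
      [/\ nonprincipal w, (d n)%:num @[n --> w] --> +oo
        & ~ has_cut_point (asymptotic_cone S Uw d)]].

Section Subgroups.
Context (G : groupType).

Definition subgroup (H : groupClosed G) : Type := {x : G | x \in H}.

HB.instance Definition _ (H : groupClosed G) :=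
  SubChoice.copy (subgroup H) {x : G | x \in H}.

Lemma subgroup_closed (H : groupClosed G) : group_closed (fun x : G => x \in H).
Proof.
split; first exact: gpred1.
by move=> x y; exact: gpredF.
Qed.

HB.instance Definition _ (H : groupClosed G) :=
  SubChoice_isSubGroup.Build G (fun x : G => x \in H) (subgroup H)
    (subgroup_closed H).

Definition finite_index (H : groupClosed G) : Prop :=
  finite_set (range (fun x : G => [set (x * h)%g | h in [set h | h \in H]])).

End Subgroups.

Definition bilipschitz_equiv (R : realType) (T : Type) (d1 d2 : T -> T -> R) :=
  exists L : R, 1 <= L /\
    forall x y, L^-1 * d1 x y <= d2 x y <= L * d1 x y.

Definition undistorted (R : realType) (G : groupType) (H : groupClosed G) :=
  finitely_generated (subgroup H) /\
  forall SH : generating_set (subgroup H), exists S : generating_set G,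
    bilipschitz_equiv
      (fun x y : subgroup H => (word_dist S (val x) (val y))%:R : R)
      (fun x y : subgroup H => (word_dist SH x y)%:R : R).

(* The word metric used to measure M-neighborhoods is the one given by S. *)
Record algebraic_network (R : realType) (G : groupType) (S : generating_set G)
    (M : R) (HH : set (groupClosed G)) : Prop := AlgebraicNetwork {
  network_finite : finite_set HH;
  network_nonempty : HH !=set0;
  network_undistorted : forall H, HH H -> undistorted R H;
  network_finite_index : exists G1 : groupClosed G,
    [/\ finite_index G1,
        forall g, exists2 h, h \in G1 & (word_dist S g h)%:R < M
      & exists S1 : generating_set (subgroup G1), forall s, gens S1 s ->
          exists2 H : groupClosed G, HH H & val s \in H];
  network_connected : forall H H', HH H -> HH H' ->
    exists (n : nat) (K : nat -> groupClosed G),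
      [/\ K 0%N = H, K n = H', forall i, (i <= n)%N -> HH (K i)
        & forall i, (i < n)%N ->
            infinite_set [set x | x \in K i /\ x \in K i.+1]] }.

Definition thick_order_zero (R : realType) (G : groupType) : Prop :=
  unconstricted R G.

Definition thick_order_at_most_one (R : realType) (G : groupType) : Prop :=
  unconstricted R G \/
  exists (S : generating_set G) (M : R) (HH : set (groupClosed G)),
    [/\ 0 < M, forall H, HH H -> unconstricted R (subgroup H)
      & algebraic_network S M HH].

Definition thick_order_one (R : realType) (G : groupType) : Prop :=
  thick_order_at_most_one R G /\ ~ thick_order_zero R G.

(* Main.v *)
Require Import Defs.
From HB Require Import structures.
From mathcomp Require Import all_boot all_order all_algebra.
From mathcomp Require Import zify lra.
From mathcomp Require Import all_classical reals interval_inference topology normedtype.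

(* Let a and d be the ends of a simple path of maximal length in the tree; they
   are leaves, attached to distinct vertices b and c.  The hyperplanes crossed
   by the ray 1, a, ad, ada, ... have stabilizers conjugate to <b> and <c>
   alternately, so a path crossing two consecutive ones, at g_i b^k and at
   g_{i+1} c^m, has length at least |k| by the exponent sum of b.  Hence, if
   the number of hyperplanes of the ray separating x from 1 differs by at least
   two from the one of y, the ray passes within d(x, y) of x.  In an asymptotic
   cone the rescaled limit of this number is therefore locally constant off the
   limit of the ray, and its origin is a cut point.
   The counting function is built without normal forms: it is prescribed by its
   increments along the edges of the Cayley graph, which only have to agree on
   commutation squares.
   For thickness, each edge of the tree gives a retract Z^2, whose cones are
   planes; edges sharing a vertex give subgroups with infinite intersection. *)

Set Implicit Arguments.
Unset Strict Implicit.
Unset Printing Implicit Defensive.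

Import Order.TTheory GRing.Theory Num.Theory.
Import numFieldNormedType.Exports.

Local Open Scope classical_set_scope.
Local Open Scope ring_scope.

(** * Word metrics *)

Section IntegerPowers.
Context (G : groupType).
Implicit Types (x y : G) (k l : int).
Local Open Scope group_scope.

Definition zexpg x k : G :=
  match k with Posz n => x ^+ n | Negz n => x ^- n.+1 end.

Lemma zexpg0 x : zexpg x 0%R = 1. Proof. by []. Qed.

Lemma zexpgS x k : zexpg x (k + 1)%R = zexpg x k * x.
Proof.
case: k => [n|[|n]].
- by rewrite -[(n%:Z + 1)%R]/((n + 1)%N%:Z) addn1 /= expgSr.
- by rewrite /= expg1 mulVg.
- rewrite (_ : (Negz n.+1 + 1)%R = Negz n); last by rewrite !NegzE; lia.
  by rewrite /= [in RHS]expgS invgM mulgVK.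
Qed.

Lemma zexpgB1 x k : zexpg x (k - 1)%R = zexpg x k * x^-1.
Proof. by rewrite -{2}[k](subrK 1%R) zexpgS mulgK. Qed.

Lemma zexpgD x k l : zexpg x (k + l)%R = zexpg x k * zexpg x l.
Proof.
elim/int_rec: l => [|n IH|n IH]; first by rewrite addr0 mulg1.
- by rewrite -addn1 PoszD addrA !zexpgS IH mulgA.
- by rewrite -addn1 PoszD opprD addrA !zexpgB1 IH mulgA.
Qed.

Lemma commute_zexpg x y k l : commute x y -> commute (zexpg x k) (zexpg y l).
Proof.
move=> xy; have xky : commute (zexpg x k) y.
  apply: commute_sym; case: k => n /=; first exact/commuteX/commute_sym.
  exact/commuteV/commuteX/commute_sym.
by case: l => n /=; [exact: commuteX|exact/commuteV/commuteX].
Qed.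

End IntegerPowers.

Section WordMetric.
Local Open Scope group_scope.
Context (G : groupType) (S : generating_set G).

Lemma products_word_length g : products S (word_length S g) g.
Proof. by have [] := word_lengthP S g. Qed.

Lemma word_length_le n g : products S n g -> (word_length S g <= n)%N.
Proof. by have [_] := word_lengthP S g; apply. Qed.

Lemma products_cons s n g : gens S s \/ gens S s^-1 -> products S n g ->
  products S n.+1 (s * g).
Proof.
move=> Ss [t [<- St ->]]; exists (s :: t); split=> [//|z|]; last by rewrite big_cons.
by rewrite inE => /predU1P[->//|/St].
Qed.

Lemma word_length_gen s : gens S s -> (word_length S s <= 1)%N.
Proof.
move=> Ss; apply: word_length_le; rewrite -[s]mulg1.
by apply: products_cons; [left|exact: products1].
Qed.

Lemma word_length1 : word_length S 1 = 0%N.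
Proof. by apply/eqP; rewrite -leqn0; apply: word_length_le; exact: products1. Qed.

Lemma word_lengthM g h :
  (word_length S (g * h) <= word_length S g + word_length S h)%N.
Proof. by apply/word_length_le/productsM; exact: products_word_length. Qed.

Lemma word_lengthV g : word_length S g^-1 = word_length S g.
Proof.
have H h : (word_length S h^-1 <= word_length S h)%N.
  by apply/word_length_le/productsV/products_word_length.
by apply/eqP; rewrite eqn_leq H -{1}[g]invgK H.
Qed.

Lemma word_lengthX g n : (word_length S (g ^+ n) <= n * word_length S g)%N.
Proof.
elim: n => [|n IH]; first by rewrite expg0 word_length1.
by rewrite expgS mulSn; apply: leq_trans (word_lengthM _ _) _; rewrite leq_add2l.
Qed.

Lemma word_length_zexpg g k :
  (word_length S (zexpg g k) <= `|k|%N * word_length S g)%N.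
Proof.
case: k => n; rewrite /= ?absz_nat; first exact: word_lengthX.
by rewrite word_lengthV; exact: word_lengthX.
Qed.

Lemma word_distxx x : word_dist S x x = 0%N.
Proof. by rewrite /word_dist mulVg word_length1. Qed.

Lemma word_distC x y : word_dist S x y = word_dist S y x.
Proof. by rewrite /word_dist -word_lengthV invgM invgK. Qed.

Lemma word_dist_triangle y x z :
  (word_dist S x z <= word_dist S x y + word_dist S y z)%N.
Proof.
rewrite /word_dist -[in X in (X <= _)%N](mulVKg y z) mulgA.
exact: word_lengthM.
Qed.

Lemma word_distM g x y : word_dist S (g * x) (g * y) = word_dist S x y.
Proof. by rewrite /word_dist invgM -mulgA mulKg. Qed.

Lemma word_dist1 g : word_dist S 1 g = word_length S g.
Proof. by rewrite /word_dist invg1 mul1g. Qed.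

(** Testing the generators suffices: an edge of the Cayley graph labelled by an inverse is an edge
    labelled by a generator, read backwards. *)
Lemma lipschitz_of_gens (F : G -> int) (C : nat) :
  (forall x s, gens S s -> (absz (F (x * s)%g - F x)%R <= C)%N) ->
  forall x y, (absz (F y - F x)%R <= C * word_dist S x y)%N.
Proof.
move=> FS x y; rewrite /word_dist.
have : products S (word_length S (x^-1 * y)) (x^-1 * y).
  exact: products_word_length.
move: (word_length _ _) => n; rewrite -{2}(mulVKg x y).
move: (x^-1 * y) => g [s [<- Ss ->]] {y g n}.
elim: s x Ss => [|a s IH] x Ss; first by rewrite big_nil mulg1 subrr.
rewrite big_cons mulgA /= mulnS.
have {}IH := IH (x * a) (fun z zs => Ss z (@mem_behead _ (a :: s) _ zs)).
suff : (absz (F (x * a)%g - F x)%R <= C)%N.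
  move=> Fa; apply: leq_trans (leq_add Fa IH).
  by rewrite addnC; exact: leqD_dist.
have [/FS//|aV] : gens S a \/ gens S a^-1 by apply: Ss; exact: mem_head.
by have := FS (x * a) _ aV; rewrite mulgK -abszN opprB.
Qed.

End WordMetric.

Section Morphism.
Local Open Scope group_scope.
Context (G H : groupType) (f : G -> H).
Hypothesis fM : {morph f : x y / x * y}.

Lemma morph1 : f 1 = 1.
Proof. by apply: (@mulgI _ (f 1)); rewrite -fM !mulg1. Qed.

Lemma morphV x : f x^-1 = (f x)^-1.
Proof. by apply: (@mulgI _ (f x)); rewrite -fM !mulgV morph1. Qed.

Lemma morph_zexpg x k : f (zexpg x k) = zexpg (f x) k.
Proof.
have fX n : f (x ^+ n) = f x ^+ n.
  by elim: n => [|n IH]; rewrite ?morph1 // !expgS fM IH.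
by case: k => n /=; rewrite ?morphV fX.
Qed.

Lemma products_morph (S : set G) n g :
  products S n g -> products (f @` S) n (f g).
Proof.
move=> [s [<- Ss ->]]; exists (map f s); split; first exact: size_map.
  move=> _ /mapP[x /Ss[xS|xS] ->]; [left; exists x|right; exists x^-1] => //.
  exact: morphV.
by rewrite big_map; apply: big_morph => //; exact: morph1.
Qed.

(** [C] is the largest length of the image of a generator. With [f] the identity this compares two
    word metrics of one group; with a retraction or an inclusion it yields undistortedness. *)
Lemma word_length_morph (S : generating_set G) (S' : generating_set H) :
  exists C : nat, forall g, (word_length S' (f g) <= C * word_length S g)%N.
Proof.
have /finite_seqP[r Sr] := gens_finite S.
exists (\max_(x <- r) word_length S' (f x))%N => g.
have := products_word_length S g; move: (word_length S g) => n [s [<- Ss ->]].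
elim: s Ss {g n} => [|a s IH] Ss; first by rewrite big_nil morph1 word_length1.
rewrite big_cons fM mulnS; apply: leq_trans (word_lengthM _ _ _) _.
apply: leq_add; last by apply: IH => z zs; apply: Ss; rewrite inE zs orbT.
have fS x : gens S x -> (word_length S' (f x) <= \max_(x <- r) word_length S' (f x))%N.
  by rewrite Sr => /= xr; apply: leq_bigmax_seq.
have [/fS//|/fS] : gens S a \/ gens S a^-1 by apply: Ss; exact: mem_head.
by rewrite morphV word_lengthV.
Qed.

End Morphism.

(** * Right angled Artin groups *)

Section Raag.
Context (T : finType) (e : rel T).
Implicit Types (s t : T) (x y : raag e).

Definition gen s : raag e := word_class _ [:: (s, false)].

Lemma gen_commute s t : e s t -> commute (gen s) (gen t).
Proof.
move=> st; rewrite /commute -!word_class_cat; apply/word_classP.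
have r : artin_relation e [:: (s, false); (t, false)] [:: (t, false); (s, false)].
  by exists s, t.
exact: (pres_relation [::] [::] r).
Qed.

Lemma word_class_cons l (w : gword T) :
  word_class _ (l :: w) =
  ((if l.2 then (gen l.1)^-1 else gen l.1) * word_class _ w)%g :> raag e.
Proof.
rewrite -cat1s word_class_cat; congr (_ * _)%g.
by case: l => s [] //=; rewrite -word_class_inv.
Qed.

Lemma raag_ind (P : raag e -> Prop) : P 1%g ->
  (forall x s, P x -> P (x * gen s)%g) ->
  (forall x s, P x -> P (x * (gen s)^-1)%g) -> forall x, P x.
Proof.
move=> P1 PM PV x; rewrite -[x]word_classK.
elim/last_ind: (repr x) => [//|w [s b] IH].
rewrite -cats1 word_class_cat word_class_cons mulg1 /=.
by case: b; [exact: PV|exact: PM].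
Qed.

Lemma gens_finite_raag : finite_set (range gen).
Proof. exact/finite_image/finite_finset. Qed.

Lemma gens_generate_raag : generates (range gen).
Proof.
move=> x; rewrite -[x]word_classK; exists (size (repr x)).
elim: (repr x) => [|[s b] w [r [sr Sr wE]]]; first exact: products1.
exists ((if b then (gen s)^-1 else gen s)%g :: r); split; first by rewrite /= sr.
  move=> z; rewrite inE => /predU1P[->|/Sr//]; case: b.
    by right; exists s => //; rewrite invgK.
  by left; exists s.
by rewrite big_cons word_class_cons wE.
Qed.

Definition raag_gens : generating_set (raag e) :=
  GeneratingSet gens_finite_raag gens_generate_raag.

(* [D x s] is the increment of a function along the edge from [x] to [x s] of
   the Cayley graph; such increments integrate to a function as soon as they
   agree along both sides of every commutation square. *)
Section Integral.
Context (D : raag e -> T -> int).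
Hypothesis D_square : forall x s t, e s t ->
  D x s + D (x * gen s)%g t = D x t + D (x * gen t)%g s.

(** An inverse letter runs backwards along the edge that ends at [x], hence the shifted base point
    and the sign. *)
Let incr x (l : T * bool) : int :=
  if l.2 then - D (x * (gen l.1)^-1)%g l.1 else D x l.1.

Let wintegral := fix wintegral x (w : gword T) : int :=
  if w is l :: w' then incr x l + wintegral (x * word_class _ [:: l])%g w'
  else 0.

Let wintegral_cat x u v :
  wintegral x (u ++ v) = wintegral x u + wintegral (x * word_class _ u)%g v.
Proof.
elim: u x => [|l u IH] x /=; first by rewrite add0r mulg1.
by rewrite IH addrA -mulgA -word_class_cat.
Qed.

(** Cancelling letters traverse the same edge in opposite directions, so their increments cancel for
    any [D]; the commutation relations are where [D_square] enters. *)
Let wintegral_eq u v : pres_eq (artin_relation e) u v ->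
  forall x, wintegral x u = wintegral x v.
Proof.
elim=> {u v} [//|u v _ IH x|u v w _ IH1 _ IH2 x|u v s b x|u v r r' + x].
- by rewrite IH.
- by rewrite IH1 IH2.
- rewrite !wintegral_cat /= !word_class_cons !mulg1 /incr; congr (_ + _).
  by case: b => /=; rewrite ?mulgVK ?mulgK ?addKr ?addNKr.
- move=> [s [t [st -> ->]]]; rewrite !wintegral_cat /=.
  congr (_ + _); rewrite !addrA !addr0 /incr /=.
  rewrite !word_class_cons /= !mulg1 D_square //; congr (_ + wintegral _ _).
  by rewrite -!mulgA; do 2!congr (_ * _)%g; exact: gen_commute.
Qed.

Definition integral x : int := wintegral 1%g (repr x).

Lemma integral1 : integral 1%g = 0.
Proof.
by rewrite /integral (@wintegral_eq _ [::]) //; exact: repr_word_class.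
Qed.

Lemma integralM_gen x s : integral (x * gen s)%g = integral x + D x s.
Proof.
rewrite /integral (@wintegral_eq _ (repr x ++ [:: (s, false)])); last first.
  rewrite -{1}[x]word_classK -word_class_cat; exact: repr_word_class.
by rewrite wintegral_cat /= addr0 mul1g word_classK.
Qed.

End Integral.

(** The increments do not depend on the vertex, so the square condition reduces to commutativity of
    addition. *)
Definition exponent_sum s : raag e -> int :=
  integral (fun _ t => (t == s)%:Z).

Lemma exponent_sumM_gen s x t :
  exponent_sum s (x * gen t)%g = exponent_sum s x + (t == s)%:Z.
Proof. by rewrite /exponent_sum integralM_gen // => *; rewrite addrC. Qed.

Lemma exponent_sum1 s : exponent_sum s 1%g = 0.
Proof. by rewrite /exponent_sum integral1 // => *; rewrite addrC. Qed.

Lemma exponent_sumM s x y :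
  exponent_sum s (x * y)%g = exponent_sum s x + exponent_sum s y.
Proof.
elim/raag_ind: y => [|y t IH|y t IH].
- by rewrite mulg1 exponent_sum1 addr0.
- by rewrite mulgA !exponent_sumM_gen IH addrA.
- apply: (addIr (t == s)%:Z); rewrite -addrA -!exponent_sumM_gen mulgVK.
  by rewrite mulgA mulgVK.
Qed.

Lemma exponent_sum_gen s t : exponent_sum s (gen t) = (t == s)%:Z.
Proof. by rewrite -[gen t]mul1g exponent_sumM_gen exponent_sum1 add0r. Qed.

Lemma exponent_sum_zexpg s t k :
  exponent_sum s (zexpg (gen t) k) = if t == s then k else 0.
Proof.
elim/int_rec: k => [|n IH|n IH].
- by rewrite exponent_sum1 if_same.
- rewrite -addn1 PoszD zexpgS exponent_sumM_gen IH.
  by case: eqP => // _; rewrite addr0.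
- apply: (addIr (t == s)%:Z); rewrite -exponent_sumM_gen -zexpgS.
  rewrite (_ : - n.+1%:Z + 1 = - n%:Z) ?IH; last by lia.
  by case: eqP => // _; lia.
Qed.

Lemma exponent_sum_lipschitz s x y :
  (absz (exponent_sum s y - exponent_sum s x)%R <= word_dist raag_gens x y)%N.
Proof.
rewrite -[word_dist _ _ _]mul1n; apply: lipschitz_of_gens => {}x _ [t _ <-].
by rewrite exponent_sumM_gen addrC addKr; case: (t == s).
Qed.

End Raag.

(** * Paths crossing two consecutive hyperplanes *)

Section Crossing.
Local Open Scope group_scope.
Context (G : groupType) (S : generating_set G) (F : G -> int).
Context (E : nat -> set G) (g : nat -> G).
Hypothesis F_step : forall x s, gens S s \/ gens S s^-1 ->
  (F (x * s)%g <= F x + 1)%R.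
Hypothesis F_cross : forall x s (i : nat), gens S s \/ gens S s^-1 ->
  F x = i -> F (x * s)%g = (i%:Z + 1)%R -> E i x.
Hypothesis E_separated : forall i x y, E i x -> E i.+1 y ->
  (word_dist S x (g i) <= word_dist S x y)%N.

(** A discrete intermediate value argument: [F] rises by at most 1 per edge, so the path first
    leaves the region [F <= i] through an edge from level [i] to level [i + 1]; [u] is the start of
    that edge. *)
Lemma path_crosses n (i : nat) x y : products S n (x^-1 * y) ->
  (F x <= i)%R -> (i%:Z + 1 <= F y)%R ->
  exists u m k, [/\ (m + k)%N = n, products S m (x^-1 * u),
    products S k (u^-1 * y), E i u & F u = i].
Proof.
elim: n x => [|n IH] x [s [sn Ss xyE]] Fx Fy.
  move: xyE; rewrite (size0nil sn) big_nil => /(congr1 (fun t => x * t)).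
  by rewrite mulVKg mulg1 => yx; move: Fx Fy; rewrite yx; lia.
case: s => [//|a s] in sn Ss xyE; case: sn => sn.
have Sa : gens S a \/ gens S a^-1 by apply: Ss; exact: mem_head.
have Py : products S n ((x * a)^-1 * y).
  exists s; split => // [z zs|]; first by apply: Ss; rewrite inE zs orbT.
  by rewrite invgM -mulgA xyE big_cons mulKg.
have [Fxa|Fxa] := leP (F (x * a)%g) i.
  have [u [m [k [mk Pu uy Eu Fu]]]] := IH _ Py Fxa Fy.
  exists u, m.+1, k; rewrite addSn mk; split => //.
  by rewrite -(mulVKg a (x^-1 * u)) [a^-1 * _]mulgA -invgM; exact: products_cons.
have Fxi : F x = i by have := lt_le_trans Fxa (F_step x Sa); lia.
exists x, 0%N, n.+1; split => //; first by rewrite mulVg; exact: products1.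
  by rewrite -(mulVKg a (x^-1 * y)) [a^-1 * _]mulgA -invgM; exact: products_cons.
apply: (F_cross Sa Fxi); apply/eqP; rewrite eq_le lezD1 Fxa andbT.
by rewrite -Fxi F_step.
Qed.

(** A geodesic from [x] to [y] meets [E i] at some [u] and later [E i.+1] at some [v]. The stretch
    from [u] to [v] is at least as long as the way from [u] to [g i], so the detour from [x] through
    [u] to [g i] is no longer than the geodesic. *)
Lemma crossing_contracts (i : nat) x y : (F x <= i)%R -> (i%:Z + 2 <= F y)%R ->
  (word_dist S x (g i) <= word_dist S x y)%N.
Proof.
move=> Fx Fy; have := products_word_length S (x^-1 * y).
rewrite -/(word_dist S x y) => /path_crosses/(_ Fx)[|u [m [k]]]; first by lia.
move=> [<- Pu uy Eu Fu].
(* The second crossing is sought on the remaining stretch from [u] to [y], so that [m] and [m']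
   measure disjoint pieces of the geodesic. *)
have [||v [m' [k' [mk' Pv _ Ev _]]]] := @path_crosses _ i.+1 u y uy; try lia.
apply: leq_trans (word_dist_triangle S u _ _) _; rewrite -mk' addnA.
apply: leq_trans (leq_addr _ _); apply: leq_add; first exact: word_length_le.
by apply: leq_trans (E_separated Eu Ev) _; exact: word_length_le.
Qed.

End Crossing.

(** * The hyperplanes of a ray of leaf generators *)

Section LeafRay.
Context (T : finType) (e : rel T) (leaf link : nat -> T).
Hypothesis e_sym : symmetric e.
Hypothesis leafP : forall i t, e (leaf i) t -> t = link i.
Hypothesis leaf_neq_link : forall i j, leaf i != link j.
Hypothesis link_neq : forall i, link i.+1 != link i.
Local Notation A := (raag e).
Local Notation gen := (gen e).

Fixpoint ray i : A := if i is j.+1 then (ray j * gen (leaf j))%g else 1%g.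

(* The vertices at which an edge of type [leaf i] starts that is dual to the
   hyperplane separating [ray i] from [ray i.+1]. *)
Definition wall i : set A := [set ray i * zexpg (gen (link i)) k | k in setT]%g.

(** The increment of the height: 1 on the edges dual to a hyperplane of the ray, 0 on all others. *)
Definition wall_cross (x : A) t : int :=
  `[< exists i, leaf i = t /\ wall i x >]%:Z.

(** The only neighbour of the leaf is [link i], and [wall i] is a left coset of the cyclic group
    that [link i] generates. *)
Lemma wallM i x t : e (leaf i) t -> wall i (x * gen t)%g <-> wall i x.
Proof.
move=> /leafP ->; split=> [[k _ kx]|[k _ <-]].
  exists (k - 1) => //; rewrite zexpgB1 mulgA kx.
  by rewrite mulgK.
by exists (k + 1) => //; rewrite zexpgS mulgA.
Qed.

(** Opposite sides of a commutation square are dual to the same hyperplane. *)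
Lemma wall_crossM x s t : e s t -> wall_cross (x * gen t)%g s = wall_cross x s.
Proof.
move=> st; congr (nat_of_bool _)%:Z; apply/asboolP/asboolP => -[i [is_ ix]];
  by exists i; split=> //; apply/(wallM x (t := t)); rewrite ?is_.
Qed.

Lemma wall_cross_square x s t : e s t ->
  wall_cross x s + wall_cross (x * gen s)%g t =
  wall_cross x t + wall_cross (x * gen t)%g s.
Proof. by move=> st; rewrite !wall_crossM 1?addrC // e_sym. Qed.

Definition height : A -> int := integral wall_cross.

Lemma height1 : height 1%g = 0.
Proof. exact: integral1 wall_cross_square. Qed.

Lemma heightM_gen x t : height (x * gen t)%g = height x + wall_cross x t.
Proof. exact: (integralM_gen wall_cross_square). Qed.

Lemma height_ray i : height (ray i) = i.
Proof.
elim: i => [|i IH] /=; first exact: height1.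
rewrite heightM_gen IH /wall_cross asboolT; first by rewrite -addn1.
by exists i; split=> //; exists 0 => //; rewrite zexpg0 mulg1.
Qed.

(** Only edges labelled by leaves change the height, and no link is a leaf of the ray. *)
Lemma height_link i x k : height (x * zexpg (gen (link i)) k)%g = height x.
Proof.
have H y : height (y * gen (link i))%g = height y.
  rewrite heightM_gen /wall_cross asboolF ?addr0 // => -[j [/eqP]].
  by rewrite (negPf (leaf_neq_link _ _)).
elim/int_rec: k => [|n IH|n IH]; first by rewrite zexpg0 mulg1.
  by rewrite -addn1 PoszD zexpgS mulgA H.
by rewrite -[in LHS]H -mulgA -zexpgS (_ : - n.+1%:Z + 1 = - n%:Z) //; lia.
Qed.

Lemma height_wall i x : wall i x -> height x = i.
Proof. by case=> k _ <-; rewrite height_link height_ray. Qed.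

Lemma height_step x s : gens (raag_gens e) s \/ gens (raag_gens e) s^-1%g ->
  height (x * s)%g <= height x + 1.
Proof.
have D01 y t : 0 <= wall_cross y t <= 1 by rewrite /wall_cross; case: asbool.
case=> [[t _ <-]|[t _ tE]]; first by rewrite heightM_gen lerD2l; case/andP: (D01 x t).
have -> : s = (gen t)^-1%g by rewrite tE invgK.
have := D01 (x * (gen t)^-1)%g t.
by have := heightM_gen (x * (gen t)^-1)%g t; rewrite mulgVK; lia.
Qed.

Lemma height_cross x s (i : nat) :
  gens (raag_gens e) s \/ gens (raag_gens e) s^-1%g ->
  height x = i -> height (x * s)%g = i%:Z + 1 -> wall i x.
Proof.
case=> [[t _ <-]|[t _ tE]] xi.
  rewrite heightM_gen xi => /addrI; rewrite /wall_cross.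
  (* The increment 1 only provides some wall [j] through [x]; the height of [x] forces [j = i]. *)
  by case: asboolP => // -[j [_ jx]] _; move: (jx) => /height_wall; rewrite xi => -[->].
(* An inverse letter runs backwards along an edge of nonnegative increment and cannot raise the
   height. *)
have -> : s = (gen t)^-1%g by rewrite tE invgK.
have := heightM_gen (x * (gen t)^-1)%g t; rewrite mulgVK xi /wall_cross.
by case: asbool => /=; lia.
Qed.

Lemma height_lipschitz x y :
  (absz (height y - height x)%R <= word_dist (raag_gens e) x y)%N.
Proof.
rewrite -[word_dist _ _ _]mul1n; apply: lipschitz_of_gens => {}x _ [t _ <-].
by rewrite heightM_gen addrC addKr /wall_cross; case: asbool.
Qed.

(* Travelling from [ray i * link i ^ k] to the next wall kills the exponent [k]
   of [link i], so it takes at least [|k|] steps. *)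
Lemma walls_separated i x y : wall i x -> wall i.+1 y ->
  (word_dist (raag_gens e) x (ray i) <= word_dist (raag_gens e) x y)%N.
Proof.
case=> k _ <- [m _ <-]; rewrite word_distC.
rewrite -[X in word_dist _ X _]mulg1 word_distM word_dist1.
apply: leq_trans (exponent_sum_lipschitz (link i) _ _).
apply: leq_trans (word_length_zexpg _ _ _) _.
apply: (@leq_trans `|k|%N).
  rewrite -[X in (_ <= X)%N]muln1 leq_mul2l word_length_gen ?orbT //.
  by exists (link i).
rewrite /= !exponent_sumM !exponent_sum_zexpg exponent_sum_gen eqxx.
by rewrite (negPf (leaf_neq_link _ _)) (negPf (link_neq _)); lia.
Qed.

Lemma ray_contracts (i : nat) x y : height x <= i -> i%:Z + 2 <= height y ->
  (word_dist (raag_gens e) x (ray i) <= word_dist (raag_gens e) x y)%N.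
Proof.
exact: (crossing_contracts height_step height_cross walls_separated).
Qed.

Lemma word_length_ray i : (word_length (raag_gens e) (ray i) <= i)%N.
Proof.
elim: i => [|i IH] /=; first by rewrite (word_length1 (raag_gens e)).
apply: leq_trans (word_lengthM (raag_gens e) _ _) _; rewrite -addn1 leq_add //.
by apply: word_length_gen; exists (leaf i).
Qed.

End LeafRay.

(** * Leaves of a tree *)

Lemma bigminn_le (I : eqType) (r : seq I) (P : pred I) (F : I -> nat) N j :
  j \in r -> P j -> (\big[minn/N]_(i <- r | P i) F i <= F j)%N.
Proof.
elim: r => [//|i r IH]; rewrite inE big_cons => /predU1P[<- ->|jr Pj].
  exact: geq_minl.
by case: ifP => _; rewrite ?geq_min IH ?orbT.
Qed.

Section TreeEnds.
Local Open Scope nat_scope.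
Context (T : finType) (e : rel T).
Hypotheses (e_sym : symmetric e) (e_irr : irreflexive e).
Hypothesis e_acyclic : forall c : seq T, ucycle e c -> size c <= 2.

Definition simple_path (s : seq T) := sorted e s && uniq s.

Lemma simple_path_rev s : simple_path (rev s) = simple_path s.
Proof.
by rewrite /simple_path rev_uniq rev_sorted; congr (_ && _); apply: eq_sorted.
Qed.

(** A neighbour of the end [x] outside the path would prolong it, against maximality; a neighbour on
    the path other than [y] would close a cycle with at least three vertices. *)
Lemma simple_path_end x y p t :
  (forall s, simple_path s -> size s <= size [:: x, y & p]) ->
  simple_path [:: x, y & p] -> e x t -> t = y.
Proof.
move=> p_max /andP[/= /andP[exy yp] /andP[xyp ypu]] xt.
have tx : t != x by apply: contraTneq xt => ->; rewrite e_irr.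
have [t_in|t_out] := boolP (t \in [:: x, y & p]); last first.
  suff /p_max : simple_path [:: t, x, y & p] by rewrite /= ltnn.
  by rewrite /simple_path /= t_out xyp ypu e_sym xt exy yp.
move: t_in; rewrite !inE (negPf tx) /= => /predU1P[//|tp].
case/splitPr: tp xyp yp ypu p_max => p1 p2 xyp yp ypu _.
suff /e_acyclic : ucycle e [:: x, y & rcons p1 t] by rewrite /= size_rcons.
move: yp ypu; rewrite -cat_rcons cat_path => /andP[yp _].
rewrite -cons_uniq -cat_cons cat_uniq => /andP[yu _].
apply/andP; split; first by rewrite /= exy rcons_path yp last_rcons e_sym.
rewrite cons_uniq yu andbT; apply: contra xyp.
by rewrite !inE mem_rcons mem_cat !inE => /or3P[->|->|->]; rewrite ?orbT.
Qed.

(** [a] and [d] are the ends of a longest simple path. Two vertices at distance at least 3 provide a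
    simple path with four vertices, so the longest one has four as well and [a], [b], [c], [d] are
    distinct. *)
Lemma tree_ends : (forall x y, connect e x y) -> 3 <= diameter e ->
  exists a b c d, [/\ e a b, e d c, forall t, e a t -> t = b,
    forall t, e d t -> t = c & uniq [:: a; b; c; d]].
Proof.
move=> e_conn diam.
have simple_size s : simple_path s -> size s <= #|T|.
  by case/andP => _ /card_uniqP <-; exact: max_card.
have [s4 s4P s4_size] : exists2 s, simple_path s & 4 <= size s.
  have [x [y]] : exists x y, 3 <= graph_dist e x y.
    apply: contrapT => far; move: diam; rewrite leqNgt => /negP; apply.
    rewrite ltnS; apply/bigmax_leqP => x _; apply/bigmax_leqP => y _.
    by rewrite -ltnS ltnNge; apply/negP => xy; apply: far; exists x, y.
  have /connectP[p0 + ->] := e_conn x y => /shortenP[p xp xpu _] {p0} far.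
  exists (x :: p); first exact/andP.
  (* [graph_dist] is a minimum over lengths below [#|T|], so the length of [p] bounds it only within
     this range. *)
  have pT : size p < #|T| by apply: (simple_size (x :: p)); exact/andP.
  rewrite /= ltnS; apply: leq_trans far _; rewrite /graph_dist.
  apply: (@bigminn_le _ _ _ (@nat_of_ord _) _ (Ordinal pT)).
    exact: mem_index_enum.
  by apply/existsP; exists (in_tuple p); rewrite xp eqxx.
pose P n := `[< exists2 s, simple_path s & size s = n >].
have exP : exists n, P n by exists (size s4); apply/asboolP; exists s4.
have P_max n : P n -> n <= #|T|.
  by move=> /asboolP[s sP <-]; exact: simple_size.
case: (ex_maxnP exP P_max) => _ /asboolP[s sP <-] s_max.
have {}s_max t : simple_path t -> size t <= size s.
  by move=> tP; apply: s_max; apply/asboolP; exists t.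
have {s4 s4P s4_size} s_size := leq_trans s4_size (s_max _ s4P).
case: s sP s_max s_size => [//|a [//|b p]] sP s_max s_size.
case/lastP: p => [//|p d] in sP s_max s_size *.
case/lastP: p => [|p c] in sP s_max s_size *; first by [].
have a_end := simple_path_end s_max sP.
have revE : rev [:: a, b & rcons (rcons p c) d] = [:: d, c & rev [:: a, b & p]].
  by rewrite -!rcons_cons !rev_rcons.
have d_end t : e d t -> t = c.
  apply: (@simple_path_end _ _ (rev [:: a, b & p])); rewrite -revE.
    by move=> r /s_max; rewrite size_rev.
  by rewrite simple_path_rev.
have dc : e d c.
  by move: sP; rewrite -simple_path_rev revE => /andP[/= /andP[]].
exists a, b, c, d; split=> //; first by case/andP: sP => /= /andP[].
case/andP: sP => _; apply: subseq_uniq.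
by rewrite -!cats1 -catA /= !eqxx suffix_subseq.
Qed.
End TreeEnds.

(** * Limits in asymptotic cones *)

Lemma metric_open (R : realType) (X : metricType R) (A : set X) :
  (forall p, A p -> exists2 r : R, 0 < r & forall q, mdist p q < r -> A q) ->
  open A.
Proof.
move=> AP; rewrite openE => p /AP[r r0 rA].
by apply/nbhs_ballP; exists r => // q; rewrite ballEmdist => /rA.
Qed.

Section Cone.
Context (R : realType) (G : groupType) (S : generating_set G).
Context (w : set_system nat) (Uw : UltraFilter w) (d : nat -> {posnum R}).
Hypothesis d_oo : (d n)%:num @[n --> w] --> +oo.
Local Notation cone := (asymptotic_cone S Uw d).
Local Notation X := (fun n => rescale_space ((d n)%:num^-1)%:pos (word_space R S)).
Local Notation base := (fun n => 1%g : X n).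
Implicit Types (p q : cone) (x y : nat -> G).

Let le_limits (u v : nat -> R) (a b : R) : u n @[n --> w] --> a ->
  v n @[n --> w] --> b -> (\forall n \near w, u n <= v n) -> a <= b.
Proof. exact: ler_cvg_to. Qed.

Let limit_cst (c : R) : c @[_ --> w] --> c.
Proof. exact: cvg_cst. Qed.

Let limitM (c : R) (u : nat -> R) (a : R) : u n @[n --> w] --> a ->
  c * u n @[n --> w] --> c * a.
Proof. by move=> ua; apply: cvgM => //; exact: cvg_cst. Qed.

Let limitD (u v : nat -> R) (a b : R) : u n @[n --> w] --> a ->
  v n @[n --> w] --> b -> u n + v n @[n --> w] --> a + b.
Proof. exact: cvgD. Qed.

Let limit_dist (u v : nat -> R) (a b : R) : u n @[n --> w] --> a ->
  v n @[n --> w] --> b -> `|u n - v n| @[n --> w] --> `|a - b|.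
Proof. by move=> ua vb; apply: cvg_norm; exact: cvgB. Qed.

Definition scaled_dist n (g h : G) : R := (word_dist S g h)%:R / (d n)%:num.

(** Lets points of the cone be handled through plain sequences in [G], hiding admissibility and the
    quotient. *)
Definition represents p x :=
  exists2 u : @ulim_seq R w X base, val u = x & ulim_class Uw u = p.

Lemma representative p : exists x, represents p x.
Proof.
by exists (val (repr p)), (repr p) => //; exact: reprK.
Qed.

Lemma scaled_dist_cvg p q x y : represents p x -> represents q y ->
  scaled_dist n (x n) (y n) @[n --> w] --> mdist p q.
Proof.
move=> [u <- <-] [v <- <-]; rewrite ultralimit_mdistE.
rewrite (_ : (fun _ => _) = fun n => mdist (val u n : X n) (val v n)).
  exact: ulim_dist_cvg.
by apply/funext => n; rewrite rescale_mdistE word_space_mdistE mulrC.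
Qed.

Lemma representable x (K : R) :
  (\forall n \near w, (word_length S (x n))%:R <= K * (d n)%:num) ->
  exists p, represents p x.
Proof.
move=> xK; have x_adm : @admissible R w X base x.
  apply/asboolP/(@ultra_cvg_bounded R w _ K) => //.
  apply: filterS xK => n xn; rewrite ger0_norm ?mdist_ge0 //.
  rewrite rescale_mdistE word_space_mdistE word_distC /= word_dist1.
  by rewrite ler_pdivrMl // mulrC.
pose u : @ulim_seq R w X base := exist _ x x_adm.
by exists (ulim_class Uw u), u.
Qed.

Lemma near_scale (K : R) : \forall n \near w, K <= (d n)%:num.
Proof. by move/cvgryPge: d_oo; apply. Qed.

Section ConeLimit.
Context (F : G -> int) (C : nat).
Hypothesis F1 : F 1%g = 0.
Hypothesis F_lip : forall g h, (absz (F h - F g)%R <= C * word_dist S g h)%N.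

Lemma scaled_lipschitz n g h :
  `|(F h)%:~R / (d n)%:num - (F g)%:~R / (d n)%:num| <=
    C%:R * scaled_dist n g h.
Proof.
rewrite -mulrBl normrM [X in _ * X]gtr0_norm ?invr_gt0 // mulrA ler_wpM2r //.
by rewrite -intrB -intr_norm -abszE -natrM ler_nat F_lip.
Qed.

(** Since [F] is Lipschitz and vanishes at 1, its rescaled values along a representing sequence are
    bounded and converge along the ultrafilter. The estimate [F_lim] gives the Lipschitz bound and,
    for [p = q], the independence of the representative. *)
Lemma cone_limit : exists L : cone -> R,
  (forall p x, represents p x -> (F (x n))%:~R / (d n)%:num @[n --> w] --> L p)
  /\ forall p q, `|L p - L q| <= C%:R * mdist p q.
Proof.
have [o oo] : exists o, represents o (fun=> 1%g).
  apply: (@representable _ 0); apply: nearW => n.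
  by rewrite word_length1 mul0r.
have F_cvg p x : represents p x -> cvg ((F (x n))%:~R / (d n)%:num @[n --> w]).
  move=> px; apply: (@ultra_cvg_bounded R w _ (C%:R * (mdist o p + 1))).
  have op1 : mdist o p < mdist o p + 1 by rewrite ltrDl.
  apply: filterS (cvgr_lt _ (scaled_dist_cvg oo px) _ op1) => n /ltW xn.
  have := scaled_lipschitz n 1%g (x n); rewrite F1 mul0r subr0 => /le_trans; apply.
  exact: ler_wpM2l.
have F_lim p q x y (a b : R) : represents p x -> represents q y ->
    (F (x n))%:~R / (d n)%:num @[n --> w] --> a ->
    (F (y n))%:~R / (d n)%:num @[n --> w] --> b -> `|a - b| <= C%:R * mdist p q.
  move=> px qy xa yb; have xy := scaled_dist_cvg qy px.
  rewrite metric_sym; apply: (le_limits (limit_dist xa yb) (@limitM C%:R _ _ xy)).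
  by apply: nearW => n; exact: scaled_lipschitz.
have [rep repP] := choice representative.
exists (fun p => lim ((F (rep p n))%:~R / (d n)%:num @[n --> w])).
split=> [p x px|p q]; last first.
  by apply: F_lim (repP p) (repP q) _ _; apply: F_cvg.
have /cvg_ex[l xl] := F_cvg _ _ px.
have := F_lim _ _ _ _ _ _ px (repP p) xl (F_cvg _ _ (repP p)).
rewrite mdistxx mulr0 normr_le0 subr_eq0 => /eqP <-.
exact: xl.
Qed.
End ConeLimit.

(* The rescaled limit of [F] is locally constant where it does not exceed [0],
   except at [o]: a short jump over [g i] happens close to [g i], which is
   close to [o] as long as [i] is sublinear. *)
Lemma ray_cut_point (F : G -> int) (C : nat) (g b : nat -> G) :
  F 1%g = 0 ->
  (forall h k, (absz (F k - F h)%R <= C * word_dist S h k)%N) ->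
  (forall i, F (g i) = i) ->
  (forall i, (word_length S (g i) <= C * i)%N) ->
  (forall (i : nat) h k, F h <= i -> i%:Z + 2 <= F k ->
    (word_dist S h (g i) <= C * word_dist S h k)%N) ->
  (forall i, F (b i) = 0) ->
  (forall i, (word_length S (b i) <= C * i)%N) ->
  (forall i, (i <= C * word_length S (b i))%N) ->
  has_cut_point cone.
Proof.
move=> F1 F_lip Fg g_len g_contr Fb b_len b_far.
have [o oo] : exists o, represents o (fun=> 1%g).
  apply: (@representable _ 0); apply: nearW => n.
  by rewrite word_length1 mul0r.
have [L [L_cvg L_lip]] := cone_limit F1 F_lip.
have Lo : L o = 0.
  apply: (cvg_unique _ (L_cvg _ _ oo)) => //.
  rewrite (_ : (fun _ => _) = fun=> 0); first exact: cvg_cst.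
  by apply/funext => n; rewrite F1 mul0r.
(* The limit of [g_contr]. The index [i] is about [r * d n] with [r] small, so [g i] is within about
   [C * r] of the origin after rescaling. *)
have far p q : L p <= 0 -> 0 < L q -> mdist p o <= C%:R * mdist p q.
  move=> Lp Lq; apply/ler_addgt0Pr => eps eps0.
  (* The first bound leaves room for [3 / 2 * r < L q]; the second makes the error [2 * C * r] at
     most [eps], the [+ 1] covering [C = 0]. *)
  pose r := Num.min (L q / 2) (eps / (2 * C%:R + 1)).
  have C0 : 0 <= C%:R :> R by [].
  have r0 : 0 < r by rewrite lt_min divr_gt0 //= divr_gt0 // ltr_wpDl // mulr_ge0.
  have rq : r <= L q / 2 by rewrite ge_min lexx.
  have re : 2 * C%:R * r <= eps.
    apply: (@le_trans _ _ ((2 * C%:R + 1) * r)); first by lra.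
    by rewrite -ler_pdivlMl ?ltr_wpDl ?mulr_ge0 // mulrC ge_min lexx orbT.
  have [x px] := representative p; have [y qy] := representative q.
  suff : mdist p o <= C%:R * mdist p q + 2 * C%:R * r.
    by move/le_trans; apply; rewrite lerD2l.
  apply: (le_limits (scaled_dist_cvg px oo)
    (limitD (@limitM C%:R _ _ (scaled_dist_cvg px qy)) (@limit_cst (2 * C%:R * r)))).
  have Lpr : L p < r by exact: le_lt_trans r0.
  have Lqr : 3 / 2 * r < L q by lra.
  near=> n; have dn0 : 0 < (d n)%:num by [].
  have Fx : (F (x n))%:~R <= r * (d n)%:num.
    rewrite -ler_pdivrMr // ltW //; near: n; exact: (cvgr_lt _ (L_cvg _ _ px)).
  have Fy : 3 / 2 * r * (d n)%:num <= (F (y n))%:~R.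
    rewrite -ler_pdivlMr // ltW //; near: n; exact: (cvgr_gt _ (L_cvg _ _ qy)).
  (* With [r * d n >= 6], [i + 2 <= r * d n + 3] is at most [3 / 2 * r * d n], hence at most
     [F (y n)]. *)
  have dn_big : 6 / r <= (d n)%:num by near: n; exact: near_scale.
  have rd6 : 6 <= r * (d n)%:num by rewrite mulrC -ler_pdivrMr.
  pose i := (Num.truncn (r * (d n)%:num)).+1.
  have i_gt : r * (d n)%:num < i%:R by exact: truncnS_gt.
  have i_le : i%:R <= r * (d n)%:num + 1.
    by rewrite -natr1 lerD2r truncn_le; lra.
  have xi : F (x n) <= i by rewrite -(ler_int R) (le_trans Fx) // ltW.
  have iy : i%:Z + 2 <= F (y n).
    by rewrite -(ler_int R) intrD (le_trans _ Fy) //; move: i_le; rewrite -pmulrn; lra.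
  have x_len : (word_dist S (x n) 1%g)%:R <=
      C%:R * (word_dist S (x n) (y n))%:R + C%:R * i%:R :> R.
    rewrite -!natrM -natrD ler_nat.
    apply: leq_trans (word_dist_triangle S (g i) _ _) (leq_add _ _).
      exact: g_contr xi iy.
    by rewrite word_distC word_dist1 g_len.
  rewrite /scaled_dist ler_pdivrMr // mulrDl -[C%:R * (_ / _) * _]mulrA divfK ?gt_eqF //.
  apply: le_trans x_len _; rewrite lerD2l -!mulrA mulrCA ler_wpM2l //.
  lra.
(* [v] and [u] show that both pieces are nonempty: [v] differs from [o] but has [L v = 0], and [u],
   on the limit of the ray, has [L u > 0]. *)
have [v ov] : exists v, represents v (fun n => b (Num.truncn (d n)%:num)).
  apply: (@representable _ C%:R); apply: nearW => n.
  rewrite (@le_trans _ _ (C * Num.truncn (d n)%:num)%:R) ?ler_nat //.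
  by rewrite natrM ler_wpM2l // truncn_le.
have [u ou] : exists u, represents u (fun n => g (Num.truncn (d n)%:num)).
  apply: (@representable _ C%:R); apply: nearW => n.
  rewrite (@le_trans _ _ (C * Num.truncn (d n)%:num)%:R) ?ler_nat //.
  by rewrite natrM ler_wpM2l // truncn_le.
have half_trunc : \forall n \near w,
    1 / 2 <= (Num.truncn (d n)%:num)%:R / (d n)%:num :> R.
  near=> n; rewrite ler_pdivlMr //.
  have : 2 <= (d n)%:num by near: n; exact: near_scale.
  by have := truncnS_gt (d n)%:num; rewrite -natr1; lra.
have Lu : 0 < L u.
  apply: (@lt_le_trans _ _ (1 / 2)) => //.
  apply: (le_limits (@limit_cst (1 / 2)) (L_cvg _ _ ou)).
  by apply: filterS half_trunc => n; rewrite Fg.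
have Lv : L v = 0.
  apply: (cvg_unique _ (L_cvg _ _ ov)) => //.
  rewrite (_ : (fun _ => _) = fun=> 0); first exact: cvg_cst.
  by apply/funext => n; rewrite Fb mul0r.
have vo : v <> o.
  move=> vo; suff : 1 / 2 <= C%:R * mdist o v by rewrite vo mdistxx mulr0; lra.
  apply: (le_limits (@limit_cst (1 / 2)) (@limitM C%:R _ _ (scaled_dist_cvg oo ov))).
  apply: filterS half_trunc => n /le_trans; apply.
  by rewrite /scaled_dist mulrA ler_wpM2r // -natrM ler_nat word_dist1.
(* [U] and [V] partition the complement of [o]. [U] is open because [L] is Lipschitz, [V] because of
   [far]. *)
pose U : set cone := [set p | 0 < L p].
pose V : set cone := [set p | p <> o /\ L p <= 0].
have C1 : 0 < C%:R + 1 :> R by rewrite ltr_wpDl.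
have Cr (r : R) : 0 < r -> 0 < r / (C%:R + 1) by move=> r0; rewrite divr_gt0.
have C_lt (r s : R) : 0 < r -> 0 <= s -> s < r / (C%:R + 1) -> C%:R * s < r.
  move=> r0 s0; rewrite ltr_pdivlMr // => /(le_lt_trans _); apply.
  by rewrite mulrC ler_wpM2l // lerDl.
have U_open : open U.
  apply: metric_open => p Lp; exists (L p / (C%:R + 1)); first exact: Cr.
  move=> q /(C_lt _ _ Lp (mdist_ge0 _ _)) pq; rewrite /U /=.
  by have := le_lt_trans (L_lip p q) pq; rewrite ltr_norml; lra.
have V_open : open V.
  apply: metric_open => p [po Lp].
  have po0 : 0 < mdist p o by rewrite mdist_gt0; exact/eqP.
  exists (mdist p o / (C%:R + 1)); first exact: Cr.
  move=> q pq; split=> [qo|].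
    move: pq; rewrite qo ltr_pdivlMr // mulrDr mulr1 gtrDr.
    by rewrite ltNge mulr_ge0 // ltW.
  rewrite leNgt; apply/negP => /(far _ _ Lp).
  by rewrite leNgt (C_lt _ _ po0 (mdist_ge0 _ _) pq).
exists o; left => /(_ U) U_all.
have oU : ~ U o by rewrite /U /= Lo ltxx.
(* If the complement of [o] were connected, its nonempty clopen subset [U] would be all of it and
   contain [v]. *)
have UE : U = ~` [set o].
  apply: U_all; first by exists u.
    by exists U => //; apply/esym/setIidPr => p Up po; apply: oU; rewrite -po.
  exists (~` V); first exact: open_closedC.
  apply/seteqP; split=> p /=.
    move=> Lp; split=> [po|[_]]; last by rewrite leNgt; apply/negP/negPn.
    by apply: oU; rewrite -po.
  by move=> [po Vp]; rewrite /U /= ltNge; apply/negP => Lp; exact: Vp.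
have : U v by rewrite UE.
by rewrite /U /= Lv ltxx.
Unshelve. all: by end_near.
Qed.

End Cone.

(** * Asymptotic cones of the free abelian group of rank 2 *)

Lemma nonprincipal_ultrafilter (R : realType) :
  exists (w : set_system nat) (_ : UltraFilter w), nonprincipal w /\
    (PosNum (ltr0Sn R n))%:num @[n --> w] --> +oo.
Proof.
have [w [Uw w_oo]] := @ultraFilterLemma nat \oo _.
exists w, Uw; split=> [n wn|].
  have w_n : w [set n] by rewrite wn; exact/principal_filterP.
  have w_Nn : w (~` [set n]).
    by apply: w_oo; exists n.+1 => // m /= nm mn; rewrite mn ltnn in nm.
  by have [m []] := filter_ex (filterI w_n w_Nn).
apply/cvgryPge => K; apply: w_oo.
exists (Num.truncn K) => // n /= Kn.
by apply/ltW/(lt_le_trans (truncnS_gt K)); rewrite ler_nat.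
Qed.

Lemma infinite_of_nat_values (T : Type) (A : set T) (f : T -> int) :
  (forall n : nat, exists2 x, A x & f x = n) -> infinite_set A.
Proof.
move=> fA A_fin; apply: infinite_nat.
apply: (@sub_finite_set _ _ (absz @` (f @` A))); last first.
  exact/finite_image/finite_image.
by move=> n _; have [x Ax fx] := fA n; exists (f x); [exists x|rewrite fx].
Qed.

Section Additive.
Context (H : groupType) (f : H -> int).
Hypothesis fM : {morph f : x y / (x * y)%g >-> x + y}.

Lemma additive1 : f 1%g = 0.
Proof. by apply: (addrI (f 1%g)); rewrite -fM mulg1 addr0. Qed.

Lemma additiveV x : f x^-1%g = - f x.
Proof. by apply: (addrI (f x)); rewrite -fM mulgV subrr additive1. Qed.

Lemma additive_zexpg x k : f (zexpg x k) = f x * k.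
Proof.
elim/int_rec: k => [|n IH|n IH]; first by rewrite additive1 ?mulr0.
  by rewrite -addn1 PoszD zexpgS fM IH mulrDr mulr1.
by rewrite -addn1 PoszD opprD zexpgB1 fM additiveV // IH; lia.
Qed.

End Additive.

Section FreeAbelianRank2.
Context (R : realType) (H : groupType) (u v : H) (fu fv : H -> int).
Hypotheses (fuM : {morph fu : x y / (x * y)%g >-> x + y})
  (fvM : {morph fv : x y / (x * y)%g >-> x + y}).
Hypotheses (fuu : fu u = 1) (fuv : fu v = 0) (fvu : fv u = 0) (fvv : fv v = 1).
Hypothesis uvE : forall h, h = (zexpg u (fu h) * zexpg v (fv h))%g.

Lemma uv_finite : finite_set [set u; v].
Proof. by rewrite finite_setU; split; exact: finite_set1. Qed.

Lemma uv_generate : generates [set u; v].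
Proof.
have products_zexpg x k : [set u; v] x ->
    exists n, products [set u; v] n (zexpg x k).
  move=> Sx; have xn n : products [set u; v] n (x ^+ n)%g.
    elim: n => [|n IH]; first exact: products1.
    rewrite expgSr -addn1; apply: productsM => //; exists [:: x]; split=> //.
      by move=> y; rewrite inE => /eqP ->; left.
    by rewrite big_seq1.
  case: k => n; first by exists n.
  by exists n.+1; exact/productsV.
move=> h; rewrite (uvE h).
have [m um] := products_zexpg u (fu h) (or_introl erefl).
have [n vn] := products_zexpg v (fv h) (or_intror erefl).
by exists (m + n)%N; exact: productsM.
Qed.

Definition uv_gens : generating_set H := GeneratingSet uv_finite uv_generate.

Lemma coordinate_lipschitz (f : H -> int) :
  {morph f : x y / (x * y)%g >-> x + y} -> (absz (f u) <= 1)%N ->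
  (absz (f v) <= 1)%N ->
  forall g h, (absz (f h - f g)%R <= 1 * word_dist uv_gens g h)%N.
Proof.
move=> fM fu1 fv1; apply: lipschitz_of_gens => x s; rewrite fM addrC addKr.
by case=> ->.
Qed.

Lemma word_length_coordinates i j :
  (word_length uv_gens (zexpg u i * zexpg v j)%g <= `|i| + `|j|)%N.
Proof.
apply: leq_trans (word_lengthM uv_gens _ _) _.
apply: leq_add; apply: leq_trans (word_length_zexpg uv_gens _ _) _.
  by rewrite -[X in (_ <= X)%N]muln1 leq_mul2l word_length_gen ?orbT //; left.
by rewrite -[X in (_ <= X)%N]muln1 leq_mul2l word_length_gen ?orbT //; right.
Qed.

Lemma word_dist_coordinates g h :
  (word_dist uv_gens g h <= absz (fu h - fu g)%R + absz (fv h - fv g)%R)%N.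
Proof.
rewrite /word_dist [(g^-1 * h)%g]uvE.
rewrite fuM fvM !additiveV // ![- _ + _]addrC.
exact: word_length_coordinates.
Qed.

Context (w : set_system nat) (Uw : UltraFilter w) (d : nat -> {posnum R}).
Hypothesis d_oo : (d n)%:num @[n --> w] --> +oo.
Local Notation cone := (asymptotic_cone uv_gens Uw d).

(** The coordinates are the rescaled limits of [fu] and [fv]. The metric bound makes them jointly
    injective with a continuous inverse. *)
Lemma plane_coordinates : exists Lu Lv : cone -> R,
  (forall p q, mdist p q <= `|Lu p - Lu q| + `|Lv p - Lv q|) /\
  (forall s t, exists p, Lu p = s /\ Lv p = t).
Proof.
have fu_lip : forall g h, (absz (fu h - fu g)%R <= 1 * word_dist uv_gens g h)%N.
  by apply: coordinate_lipschitz; rewrite ?fuu ?fuv.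
have fv_lip : forall g h, (absz (fv h - fv g)%R <= 1 * word_dist uv_gens g h)%N.
  by apply: coordinate_lipschitz; rewrite ?fvu ?fvv.
have [Lu [Lu_cvg _]] := cone_limit Uw d (additive1 fuM) fu_lip.
have [Lv [Lv_cvg _]] := cone_limit Uw d (additive1 fvM) fv_lip.
exists Lu, Lv; split=> [p q|s t].
  have [x px] := representative p; have [y qy] := representative q.
  have Luv : `|(fu (x n))%:~R / (d n)%:num - (fu (y n))%:~R / (d n)%:num| +
      `|(fv (x n))%:~R / (d n)%:num - (fv (y n))%:~R / (d n)%:num|
      @[n --> w] --> `|Lu p - Lu q| + `|Lv p - Lv q|.
    apply: cvgD; apply: cvg_norm; apply: cvgB.
    - exact: Lu_cvg px.
    - exact: Lu_cvg qy.
    - exact: Lv_cvg px.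
    - exact: Lv_cvg qy.
  rewrite metric_sym.
  apply: (@ler_cvg_to _ w _ _ _ _ _ _ (scaled_dist_cvg qy px) Luv).
  apply: nearW => n; rewrite -!mulrBl !normrM.
  rewrite [`|_^-1|]gtr0_norm ?invr_gt0 // -mulrDl ler_wpM2r //.
  rewrite -!intrB -!intr_norm -!abszE -!pmulrn -natrD ler_nat.
  exact: word_dist_coordinates.
have floor_cvg (r : R) :
    (Num.floor (r * (d n)%:num))%:~R / (d n)%:num @[n --> w] --> r.
  apply/cvgrPdist_le => eps eps0; near=> n.
  have dn : eps^-1 <= (d n)%:num by near: n; exact: near_scale.
  have /andP[fl fg] := floor_itv (r * (d n)%:num).
  have dn0 : 0 < (d n)%:num by [].
  rewrite ger0_norm ?subr_ge0 ?ler_pdivrMr // lerBlDr -(ler_pM2r dn0).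
  rewrite mulrDl divfK ?gt_eqF //; move: dn; rewrite -div1r ler_pdivrMr //.
  by move: fg; rewrite intrD; lra.
have floor_norm (r : R) : (absz (Num.floor r))%:R <= `|r| + 1.
  rewrite pmulrn abszE intr_norm ler_norml.
  have /andP[] := floor_itv r; rewrite intrD.
  have := ler_norm r; have := ler_norm (- r); rewrite normrN.
  by move=> *; apply/andP; split; lra.
(* The point with coordinates [s] and [t] is approximated by lattice points; each floor costs at
   most 1, hence at most [d n], which explains the constant [|s| + |t| + 2]. *)
have [p px] : exists p : cone, represents p (fun n =>
    zexpg u (Num.floor (s * (d n)%:num)) * zexpg v (Num.floor (t * (d n)%:num)))%g.
  apply: (@representable _ _ _ _ _ _ _ (`|s| + `|t| + 2)); near=> n.
  have dn : 1 <= (d n)%:num by near: n; exact: near_scale.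
  apply: (@le_trans _ _ (_ + _)%:R).
    by rewrite ler_nat; exact: word_length_coordinates.
  rewrite natrD.
  apply: le_trans (lerD (floor_norm _) (floor_norm _)) _.
  by rewrite !normrM ![`|(d n)%:num|]ger0_norm //; nra.
exists p; split.
  apply: (cvg_unique _ (Lu_cvg _ _ px)) => //.
  rewrite (_ : (fun _ => _) = fun n => (Num.floor (s * (d n)%:num))%:~R / (d n)%:num).
    exact: floor_cvg.
  by apply/funext => n; rewrite fuM !additive_zexpg // fuu fuv mul1r mul0r addr0.
apply: (cvg_unique _ (Lv_cvg _ _ px)) => //.
rewrite (_ : (fun _ => _) = fun n => (Num.floor (t * (d n)%:num))%:~R / (d n)%:num).
  exact: floor_cvg.
by apply/funext => n; rewrite fvM !additive_zexpg // fvu fvv mul1r mul0r add0r.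
Unshelve. all: by end_near.
Qed.
End FreeAbelianRank2.

(** * Planes have no cut points *)

Section Plane.
Context (R : realType) (X : metricType R) (Lu Lv : X -> R).
Hypothesis mdist_le : forall p q, mdist p q <= `|Lu p - Lu q| + `|Lv p - Lv q|.
Hypothesis L_surj : forall s t, exists p, Lu p = s /\ Lv p = t.

Lemma coordinates_inj p q : Lu p = Lu q -> Lv p = Lv q -> p = q.
Proof.
move=> pqu pqv; apply: mdist_positivity; apply/eqP.
by rewrite eq_le mdist_ge0 andbT (le_trans (mdist_le _ _)) // pqu pqv !subrr normr0 addr0.
Qed.

(** The affine segment between the coordinates lifts to [X]; the lift is continuous because the
    coordinates bound the metric. *)
Lemma segment_component p q q' :
  (forall c, 0 <= c <= 1 -> Lu q + c * (Lu q' - Lu q) = Lu p ->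
    Lv q + c * (Lv q' - Lv q) = Lv p -> False) ->
  connected_component (~` [set p]) q q'.
Proof.
move=> avoid.
have [f fP] := choice (fun c => L_surj (Lu q + c * (Lu q' - Lu q))
  (Lv q + c * (Lv q' - Lv q))).
have f_cont : continuous f.
  move=> c; apply/cvg_ballP => eps eps0.
  pose K := `|Lu q' - Lu q| + `|Lv q' - Lv q|.
  have K1 : 0 < K + 1 by rewrite ltr_wpDl // addr_ge0.
  apply/nbhs_ballP; exists (eps / (K + 1)); first by rewrite /= divr_gt0.
  move=> c' c_c'; have : `|c - c'| < eps / (K + 1) by exact: c_c'.
  rewrite ltr_pdivlMr // => {c_c'} cc'.
  rewrite ballEmdist /=.
  apply: le_lt_trans (mdist_le _ _) _; apply: le_lt_trans cc'.
  have [-> ->] := fP c; have [-> ->] := fP c'.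
  have E (a b : R) : a + c * b - (a + c' * b) = (c - c') * b.
    by rewrite opprD addrACA subrr add0r mulrBl.
  by rewrite !E !normrM -mulrDr ler_wpM2l // lerDl.
exists (f @` `[0, 1]); last first.
  exists 1; first by rewrite /= in_itv /= ler01 lexx.
  by have [fu fv] := fP 1; apply: coordinates_inj; rewrite ?fu ?fv mul1r addrC subrK.
split.
- exists 0; first by rewrite /= in_itv /= ler01 lexx.
  by have [fu fv] := fP 0; apply: coordinates_inj; rewrite ?fu ?fv mul0r addr0.
- move=> _ [c c01 <-] fc; have [fu fv] := fP c.
  by apply: (avoid c); rewrite -?fu -?fv ?fc //; move: c01; rewrite /= in_itv.
- apply: connected_continuous_connected; first exact: segment_connected.
  exact: continuous_subspaceT.
Qed.

(* Any point [q] is joined to a fixed point [z] on the right of [p] by at most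
   three segments avoiding [p]. *)
Lemma plane_no_cut_point : ~ has_cut_point X.
Proof.
case=> p [|pT]; last first.
  have [q [qu _]] := L_surj (Lu p + 1) 0.
  have : [set p] q by rewrite -pT.
  by move=> qp; move: qu; rewrite qp; lra.
apply; have [z [zu zv]] := L_surj (Lu p + 1) (Lv p).
pose P := ~` [set p].
have right_z q : Lu p < Lu q -> connected_component P q z.
  move=> pq; apply: segment_component => c /andP[c0 c1] + _; rewrite zu.
  (* Meeting [p] would mean [(1 - c) * (Lu q - Lu p) + c = 0], a sum of two nonnegative terms that
     do not vanish together. *)
  have : 0 <= (1 - c) * (Lu q - Lu p) by rewrite mulr_ge0 // subr_ge0 // ltW.
  have [->|cN0] := eqVneq c 0; first by lra.
  have : 0 < c by rewrite lt_def cN0 c0.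
  lra.
have off_z q : Lv p <> Lv q -> connected_component P q z.
  move=> pq; have [q' [qu qv]] := L_surj (Lu p + 1) (Lv q).
  apply: (@connected_component_trans _ _ q'); last by apply: right_z; rewrite qu; lra.
  by apply: segment_component => c c01 _; rewrite qv subrr mulr0 addr0 => /esym.
have all_z q : P q -> connected_component P q z.
  move=> qp; have [pq|pq] := eqVneq (Lv p) (Lv q); last by apply: off_z; exact/eqP.
  (* On the horizontal line through [p], first leave it vertically: this segment misses [p] because
     [Lu q] differs from [Lu p]. *)
  have [q' [qu qv]] := L_surj (Lu q) (Lv p + 1).
  apply: (@connected_component_trans _ _ q'); last by apply: off_z; rewrite qv; lra.
  apply: segment_component => c c01; rewrite qu subrr mulr0 addr0 => quE _.
  by apply: qp; apply: coordinates_inj.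
suff PE : P = connected_component P z.
  by rewrite -/P PE; exact: component_connected.
apply/seteqP; split=> q; last exact: connected_component_sub.
by move=> /all_z; exact: connected_component_sym.
Qed.

End Plane.

(** The hypotheses say that [fu] and [fv] are the coordinates of an isomorphism from [H] to Z^2 in
    the basis [u], [v]. One cone without cut points is enough, here with scales [n + 1]. *)
Lemma rank2_unconstricted (R : realType) (H : groupType) (u v : H)
    (fu fv : H -> int) :
  {morph fu : x y / (x * y)%g >-> x + y} ->
  {morph fv : x y / (x * y)%g >-> x + y} ->
  fu u = 1 -> fu v = 0 -> fv u = 0 -> fv v = 1 ->
  (forall h, h = (zexpg u (fu h) * zexpg v (fv h))%g) ->
  unconstricted R H.
Proof.
move=> fuM fvM fuu fuv fvu fvv uvE.
split.
- apply: (@infinite_of_nat_values _ _ fu) => n; exists (zexpg u n) => //.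
  by rewrite additive_zexpg // fuu mul1r.
- exists [set u; v]; split; [exact: uv_finite|exact: uv_generate uvE].
- have [w [Uw [w_np w_oo]]] := nonprincipal_ultrafilter R.
  exists (uv_gens uvE), w, Uw, (fun n => PosNum (ltr0Sn R n)); split=> //.
  have [Lu [Lv [L_dist L_surj]]] :=
    plane_coordinates fuM fvM fuu fuv fvu fvv uvE Uw w_oo.
  exact: plane_no_cut_point L_dist L_surj.
Qed.

(** * Edge subgroups *)

(** The inclusion and the retraction are both homomorphisms, hence Lipschitz for the word metrics,
    and they bound the two metrics by each other. *)
Lemma retract_undistorted (R : realType) (G : groupType) (S : generating_set G)
    (H : groupClosed G) (f : G -> subgroup H) :
  {morph f : x y / (x * y)%g} -> (forall h, f (val h) = h) ->
  finitely_generated (subgroup H) -> undistorted R H.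
Proof.
move=> fM fK H_fg; split=> // SH; exists S.
have [C1 fC1] := word_length_morph fM S SH.
have valM : {morph (val : subgroup H -> G) : x y / (x * y)%g} by [].
have [C2 valC2] := word_length_morph valM SH S.
have L0 : 0 < (C1 + C2).+1%:R :> R by [].
exists (C1 + C2).+1%:R; split=> [|x y]; first by rewrite ler1n.
apply/andP; split.
  rewrite ler_pdivrMl // -natrM ler_nat /word_dist.
  have := valC2 (x^-1 * y)%g; rewrite valM (morphV valM) => /leq_trans; apply.
  by rewrite leq_mul2r -addnS -addSnnS addnC leq_addr orbT.
rewrite -natrM ler_nat /word_dist.
have := fC1 ((val x)^-1 * val y)%g; rewrite fM (morphV fM) !fK => /leq_trans; apply.
by rewrite leq_mul2r -addnS leq_addr orbT.
Qed.

Section WholeGroup.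
Local Open Scope group_scope.
Context (G : groupType).

(** Serves as the finite index subgroup of the network. *)
Definition whole : {pred G} := predT.

HB.instance Definition _ := isMulClosed.Build G whole (fun _ _ _ _ => isT).
HB.instance Definition _ := isMul1Closed.Build G whole isT.
HB.instance Definition _ := isInvClosed.Build G whole (fun _ _ => isT).

Definition whole_group : groupClosed G := whole.

Lemma whole_finite_index : finite_index whole_group.
Proof.
apply: (@sub_finite_set _ _ [set [set: G]]); last exact: finite_set1.
move=> _ [x _ <-] /=; apply/seteqP; split=> // g _.
by exists (x^-1 * g) => //; rewrite mulVKg.
Qed.

Definition to_whole (g : G) : subgroup whole_group := exist _ g isT.

Context (S : generating_set G).

Lemma whole_gens_finite : finite_set (to_whole @` gens S).
Proof. exact/finite_image/gens_finite. Qed.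

Lemma whole_gens_generate : generates (to_whole @` gens S).
Proof.
move=> g; have [n Sg] := gens_generate S (val g); exists n.
have -> : g = to_whole (val g) by exact: val_inj.
apply: products_morph Sg => x y; exact: val_inj.
Qed.

Definition whole_gens : generating_set (subgroup whole_group) :=
  GeneratingSet whole_gens_finite whole_gens_generate.

End WholeGroup.

Section EdgeSubgroups.
Context (T : finType) (e : rel T).
Hypotheses (e_sym : symmetric e) (e_irr : irreflexive e).
Local Notation A := (raag e).
Local Notation gen := (gen e).

Definition edge := {a : T * T | e a.1 a.2}.
Implicit Types (a b : edge) (g h : A) (s t : T).

(** The retraction onto the Z^2 of an edge that kills all other generators, written with exponent
    sums so that no word has to be chosen. *)
Definition edge_retract a g : A :=
  (zexpg (gen (val a).1) (exponent_sum (val a).1 g) *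
   zexpg (gen (val a).2) (exponent_sum (val a).2 g))%g.

Lemma edge_retractM a : {morph edge_retract a : g h / (g * h)%g}.
Proof.
move=> g h; rewrite /edge_retract !exponent_sumM !zexpgD -!mulgA.
congr (_ * _)%g; rewrite !mulgA; congr (_ * _)%g.
by apply: commute_zexpg; apply: gen_commute; exact: (valP a).
Qed.

(** Taken as the fixed points of the retraction, so that membership is the very decomposition into
    powers that identifies the subgroup with Z^2. *)
Definition edge_subgroup a : {pred A} := [pred g | edge_retract a g == g].

Let edge_subgroupM a : {in edge_subgroup a &, forall g h, (g * h)%g \in edge_subgroup a}.
Proof. by move=> g h; rewrite !inE edge_retractM => /eqP -> /eqP ->. Qed.

Let edge_subgroup1 a : 1%g \in edge_subgroup a.
Proof. by rewrite inE (morph1 (@edge_retractM a)). Qed.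

Let edge_subgroupV a : {in edge_subgroup a, forall g, (g^-1)%g \in edge_subgroup a}.
Proof. by move=> g; rewrite !inE (morphV (@edge_retractM a)) => /eqP ->. Qed.

HB.instance Definition _ a :=
  isMulClosed.Build A (edge_subgroup a) (@edge_subgroupM a).
HB.instance Definition _ a :=
  isMul1Closed.Build A (edge_subgroup a) (@edge_subgroup1 a).
HB.instance Definition _ a :=
  isInvClosed.Build A (edge_subgroup a) (@edge_subgroupV a).

Definition edge_group a : groupClosed A := edge_subgroup a.

Lemma edge_neq a : ((val a).1 == (val a).2) = false.
Proof. by apply: contraTF (valP a) => /eqP ->; rewrite e_irr. Qed.

Lemma mem_edge_group a s k : (s == (val a).1) || (s == (val a).2) ->
  zexpg (gen s) k \in edge_group a.
Proof.
rewrite inE /edge_retract !exponent_sum_zexpg.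
by case/orP => /eqP ->; rewrite eqxx ?edge_neq ?[_ == (val a).1]eq_sym ?edge_neq
  ?zexpg0 ?mulg1 ?mul1g.
Qed.

Lemma edge_retract_in a g : edge_retract a g \in edge_group a.
Proof.
by apply: gpredM; apply: mem_edge_group; rewrite eqxx ?orbT.
Qed.

Definition edge_projection a g : subgroup (edge_group a) :=
  exist _ (edge_retract a g) (edge_retract_in a g).

Lemma edge_projectionM a : {morph edge_projection a : g h / (g * h)%g}.
Proof. by move=> g h; apply: val_inj; exact: edge_retractM. Qed.

Lemma edge_projectionK a (g : subgroup (edge_group a)) :
  edge_projection a (val g) = g.
Proof. by apply: val_inj; apply/eqP; have := valP g; rewrite inE. Qed.

Lemma edge_unconstricted (R : realType) a : unconstricted R (subgroup (edge_group a)).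
Proof.
have valM : {morph (val : subgroup (edge_group a) -> A) : g h / (g * h)%g} by [].
pose s := (val a).1; pose t := (val a).2.
have st : (s == t) = false by exact: edge_neq.
have s_in : gen s \in edge_group a by apply: (@mem_edge_group a s 1); rewrite eqxx.
have t_in : gen t \in edge_group a by apply: (@mem_edge_group a t 1); rewrite eqxx orbT.
pose u : subgroup (edge_group a) := exist _ (gen s) s_in.
pose v : subgroup (edge_group a) := exist _ (gen t) t_in.
pose fu (g : subgroup (edge_group a)) := exponent_sum s (val g).
pose fv (g : subgroup (edge_group a)) := exponent_sum t (val g).
apply: (@rank2_unconstricted R _ u v fu fv) => [g h|g h|||||h]; rewrite ?/fu ?/fv.
- by rewrite valM exponent_sumM.
- by rewrite valM exponent_sumM.
- by rewrite exponent_sum_gen eqxx.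
- by rewrite exponent_sum_gen eq_sym st.
- by rewrite exponent_sum_gen st.
- by rewrite exponent_sum_gen eqxx.
- apply: val_inj; rewrite valM !(morph_zexpg valM) /=.
  by have := valP h; rewrite inE => /eqP.
Qed.

Lemma edge_undistorted (R : realType) a : undistorted R (edge_group a).
Proof.
apply: (@retract_undistorted R _ (raag_gens e) _ (@edge_projection a)).
- exact: edge_projectionM.
- exact: edge_projectionK.
- by have [] := edge_unconstricted R a.
Qed.

Lemma edge_groups_meet a b s :
  (s == (val a).1) || (s == (val a).2) -> (s == (val b).1) || (s == (val b).2) ->
  infinite_set [set g | g \in edge_group a /\ g \in edge_group b].
Proof.
move=> sa sb; apply: (@infinite_of_nat_values _ _ (exponent_sum s)) => n.
exists (zexpg (gen s) n); first by split; exact: mem_edge_group.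
by rewrite exponent_sum_zexpg eqxx.
Qed.

Hypothesis e_conn : forall s t, connect e s t.
Hypothesis e_edge : forall s, exists t, e s t.

Lemma edge_groups_connected a b : exists (n : nat) (K : nat -> groupClosed A),
  [/\ K 0%N = edge_group a, K n = edge_group b,
    forall i, (i <= n)%N -> range edge_group (K i)
    & forall i, (i < n)%N -> infinite_set [set g | g \in K i /\ g \in K i.+1]].
Proof.
have /connectP[p] := e_conn (val a).1 (val b).1.
elim: p a => [|s p IH] a /=.
  move=> _ ba; exists 1%N, (fun i => if i is 0%N then edge_group a else edge_group b).
  split=> // [[|i] _|[|//] _]; [by exists a|by exists b|].
  by apply: (@edge_groups_meet _ _ (val a).1); rewrite -?ba eqxx.
move=> /andP[a1s sp] bp.
have s_a : e s (val a).1 by rewrite e_sym.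
(* The edge just crossed by the path, oriented to start at [s] so that the induction continues; it
   shares [(val a).1] with [a]. *)
pose c : edge := exist _ (s, (val a).1) s_a.
have [n [K [K0 Kn KH K_meet]]] := IH c sp bp.
exists n.+1, (fun i => if i is j.+1 then K j else edge_group a).
split=> // [[|i]|[|i]]; [by exists a|exact: KH| |exact: K_meet].
by move=> _; rewrite K0; apply: (@edge_groups_meet _ _ (val a).1); rewrite eqxx ?orbT.
Qed.

Lemma edge_network (R : realType) (t0 : T) :
  algebraic_network (raag_gens e) (1 : R) (range edge_group).
Proof.
have [t1 e01] := e_edge t0.
split.
- exact/finite_image/finite_finset.
- by exists (edge_group (exist _ (t0, t1) e01)), (exist _ (t0, t1) e01).
- by move=> _ [a _ <-]; exact: edge_undistorted.
- exists (whole_group A); split; first exact: whole_finite_index.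
    by move=> g; exists g => //; rewrite word_distxx ltr01.
  exists (whole_gens (raag_gens e)) => _ [_ [s _ <-] <-].
  have [t st] := e_edge s; pose a : edge := exist _ (s, t) st.
  exists (edge_group a); first by exists a.
  by apply: (@mem_edge_group a s 1); rewrite eqxx.
- by move=> _ _ [a _ <-] [b _ <-]; exact: edge_groups_connected.
Qed.

End EdgeSubgroups.

(** * Cut points in every cone, and thickness of order one *)

Lemma raag_cone_cut_point (R : realType) (T : finType) (e : rel T)
    (e_sym : symmetric e) (leaf link : nat -> T) :
  (forall i t, e (leaf i) t -> t = link i) ->
  (forall i j, leaf i != link j) -> (forall i, link i.+1 != link i) ->
  forall (S : generating_set (raag e)) (w : set_system nat)
    (Uw : UltraFilter w) (d : nat -> {posnum R}),
  (d n)%:num @[n --> w] --> +oo -> has_cut_point (asymptotic_cone S Uw d).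
Proof.
move=> leafP leaf_link link_neq S w Uw d d_oo; pose V := raag_gens e.
have [C1 SV] : exists C, forall g, (word_length V g <= C * word_length S g)%N.
  by apply: (@word_length_morph _ _ id).
have [C2 VS] : exists C, forall g, (word_length S g <= C * word_length V g)%N.
  by apply: (@word_length_morph _ _ id).
(* The estimates hold for the standard generators. Passing to [S] costs [C1] or [C2], and both
   factors for the contraction. *)
pose C := (C1 + C2 + C2 * C1)%N.
have C1C : (C1 <= C)%N by rewrite /C -addnA leq_addr.
have C2C : (C2 <= C)%N by rewrite /C addnAC leq_addl.
have C12C : (C2 * C1 <= C)%N by rewrite /C leq_addl.
have b_len i : (word_length V (gen e (link 0%N) ^+ i)%g <= i)%N.
  apply: leq_trans (word_lengthX V _ _) _; rewrite -[leqRHS]muln1 leq_mul2l.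
  by rewrite word_length_gen ?orbT //; exists (link 0%N).
(* The powers of [link 0] stay at height 0, while their exponent sum shows that they leave the
   origin linearly. *)
apply: (@ray_cut_point _ _ _ _ _ _ d_oo (height leaf link) C (ray e leaf)
  (fun i => gen e (link 0%N) ^+ i)%g).
- exact: height1 e_sym leafP.
- move=> x y; apply: leq_trans (height_lipschitz e_sym leafP _ _) _.
  by apply: leq_trans (SV _) _; rewrite leq_mul2r C1C orbT.
- exact: height_ray e_sym leafP.
- move=> i; apply: leq_trans (VS _) _; apply: leq_mul => //.
  exact: word_length_ray.
- move=> i x y xi yi; apply: leq_trans (VS _) _.
  apply: (@leq_trans (C2 * (C1 * word_dist S x y))).
    rewrite leq_mul2l; apply/orP; right; apply: leq_trans (SV _).
    exact: (ray_contracts e_sym leafP).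
  by rewrite mulnA leq_mul2r C12C orbT.
- move=> i; have := height_link e_sym leafP leaf_link 0%N 1%g i.
  by rewrite mul1g (height1 e_sym leafP).
- by move=> i; apply: leq_trans (VS _) _; apply: leq_mul.
- move=> i.
  apply: (@leq_trans (C1 * word_length S (gen e (link 0%N) ^+ i)%g)); last first.
    by rewrite leq_mul2r C1C orbT.
  apply: leq_trans (SV _).
  have := exponent_sum_lipschitz (link 0%N) 1%g (gen e (link 0%N) ^+ i)%g.
  rewrite exponent_sum1 subr0 (exponent_sum_zexpg e (link 0%N) (link 0%N) i) eqxx.
  by rewrite word_dist1.
Qed.


Theorem corollary10p9 (R : realType) (T : finType) (e : rel T)
    (e_simplicial : simplicial_graph e) (e_tree : is_tree e)
    (e_diam : (3 <= diameter e)%N) :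
  (forall (S : generating_set (raag e)) (w : set_system nat)
      (Uw : UltraFilter w) (d : nat -> {posnum R}),
    nonprincipal w -> (d n)%:num @[n --> w] --> +oo ->
    has_cut_point (asymptotic_cone S Uw d)) /\
  thick_order_one R (raag e).
Proof.
have [e_sym e_irr] := e_simplicial; have [_ e_conn e_acyclic] := e_tree.
have [a [b [c [d [ab dc aP dP]]]]] := tree_ends e_sym e_irr e_acyclic e_conn e_diam.
rewrite /= !inE !negb_or -!andbA => /and5P[ab' ac ad bc /and3P[bd cd _]].
(* Alternating the two leaves gives the ray 1, a, ad, ada, and makes consecutive links distinct. *)
pose leaf i := if odd i then d else a.
pose link i := if odd i then c else b.
have leafP i t : e (leaf i) t -> t = link i.
  by rewrite /leaf /link; case: odd => [/dP|/aP].
have leaf_link i j : leaf i != link j.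
  by rewrite /leaf /link; case: odd; case: odd; rewrite // eq_sym.
have link_neq i : link i.+1 != link i.
  by rewrite /link /=; case: odd; rewrite //= eq_sym.
have cut_points := raag_cone_cut_point (R := R) e_sym leafP leaf_link link_neq.
split; first by move=> S w Uw dn _; exact: cut_points.
split; last first.
  by case=> _ _ [S [w [Uw [dn [_ dn_oo]]]]]; apply; exact: cut_points.
right; exists (raag_gens e), 1, (range (@edge_group _ e)); split=> //.
  by move=> _ [x _ <-]; exact: edge_unconstricted.
apply: edge_network => // s.
(* A neighbour of [s] is the first step of a path to any other vertex, and [a] or [b] is such a
   vertex. *)
have [t st] : exists t, t != s.
  by have [->|?] := eqVneq s a; [exists b; rewrite eq_sym|exists a; rewrite eq_sym].
have /connectP[[|t' p] /=] := e_conn s t; first by move=> _ ts; rewrite ts eqxx in st.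
by case/andP => st' _ _; exists t'.
Qed.
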